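(* Let $M$ be a smooth manifold modeled on a Banach space $\mathbb{E}$. If the second order tangent bundle $T^{2}M$ of $M$ admits a vector bundle structure over $M$, with fibers of type $\mathbb{E}\times\mathbb{E}$, isomorphic to the product of vector bundles $TM\times TM$, then a linear connection can be defined on $M$.
   Context: $M$ is a $C^\infty$-manifold modeled on a Banach space $\mathbb{E}$ with atlas $\{(U_\alpha,\psi_\alpha)\}_{\alpha\in I}$. Second order tangent bundle. For $x\in M$ let $C_x$ be the set of smooth curves $f:(-\varepsilon,\varepsilon)\to M$ ($\varepsilon>0$) with $f(0)=x$. For such a curve, $f':(-\varepsilon,\varepsilon)\to TM$, $f'(t)=[df(t)](1)$, and $f'':(-\varepsilon,\varepsilon)\to T(TM)$, $f''(t)=[df'(t)](1)$. Define $f\approx_x g$ if and only if $f'(0)=g'(0)$ and $f''(0)=g''(0)$. The tangent space of order two at $x$ is $T_x^2M=C_x/\approx_x$, and the class of $f$ is written $[f,x]_2$. The tangent bundle of order two is $T^2M=\bigcup_{x\in M}T_x^2M$, with natural projection $\pi_2:T^2M\to M$, $\pi_2([f,x]_2)=x$. $TM\times TM$ denotes the product of the vector bundle $TM$ with itself as a vector bundle over $M$, with fiber $T_xM\times T_xM$ over $x\in M$. Connections. Let $\pi_M:TM\to M$ and $\pi_{TM}:T(TM)\to TM$ be the tangent bundle projections, let $\Psi_\alpha:\pi_M^{-1}(U_\alpha)\to\psi_\alpha(U_\alpha)\times\mathbb{E}$, $[c,x]\mapsto(\psi_\alpha(x),(\psi_\alpha\circ c)'(0))$ be the charts of $TM$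 induced by $\psi_\alpha$ (where $[c,x]$ is the tangent vector of the smooth curve $c$ with $c(0)=x$), and let $\widetilde\Psi_\alpha$ be the corresponding induced charts of $T(TM)$, defined on $\pi_{TM}^{-1}(\pi_M^{-1}(U_\alpha))$. A connection on $M$ (in the sense of Vilms) is a vector bundle morphism $D:T(TM)\to TM$ whose local forms $D_\alpha:=\Psi_\alpha\circ D\circ\widetilde\Psi_\alpha^{-1}:\psi_\alpha(U_\alpha)\times\mathbb{E}\times\mathbb{E}\times\mathbb{E}\to\psi_\alpha(U_\alpha)\times\mathbb{E}$ are given by $D_\alpha(y,u,v,w)=(y,w+\omega_\alpha(y,u)\cdot v)$ with smooth mappings $\omega_\alpha:\psi_\alpha(U_\alpha)\times\mathbb{E}\to\mathcal{L}(\mathbb{E},\mathbb{E})$. The connection $D$ is linear if every $\omega_\alpha$ is linear in its second variable. A linear connection is fully characterized by its Christoffel symbols, the smooth mappings $\Gamma_\alpha:\psi_\alpha(U_\alpha)\to\mathcal{L}(\mathbb{E},\mathcal{L}(\mathbb{E},\mathbb{E}))$, $\Gamma_\alpha(y)[u]=\omega_\alpha(y,u)$, which with $\sigma_{\alpha\beta}=\psi_\alpha\circ\psi_\beta^{-1}$ satisfy on overlaps $$\Gamma_\alpha(\sigma_{\alpha\beta}(y))(d\sigma_{\alpha\beta}(y)(u))[d\sigma_{\alpha\beta}(y)(v)]+(d^2\sigma_{\alpha\beta}(y)(v))(u)=d\sigma_{\alpha\beta}(y)\big((\Gamma_\beta(y)(u))(v)\big).$$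
   Formalization: The vector bundle structure on the second order tangent bundle is required to be compatible with its natural smooth structure (charts given by the point and the first and second derivatives of curves); with an arbitrary structure on the set the claim fails, e.g. for the long line. *)

(* Defs.v *)
From HB Require Import structures.
From mathcomp Require Import all_boot all_order all_algebra.
From mathcomp Require Import all_classical all_reals all_analysis.

Set Implicit Arguments.
Unset Strict Implicit.
Unset Printing Implicit Defensive.

Import Order.TTheory GRing.Theory Num.Theory.
Import numFieldNormedType.Exports.

Local Open Scope classical_set_scope.
Local Open Scope quotient_scope.
Local Open Scope ring_scope.

Section continuous_linear_maps.
Context {R : realType} {E F : normedModType R}.
Implicit Types f g : E -> F.

Definition cont_linear : {pred (E -> F)} :=
  [pred f | `[< linear f /\ continuous f >]].

Lemma cont_linearP f : reflect (linear f /\ continuous f) (f \in cont_linear).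
Proof. exact: asboolP. Qed.

Lemma cont_linear_submod_closed : submod_closed cont_linear.
Proof.
split; first by apply/cont_linearP; split=> [a x y|x];
  [rewrite /GRing.zero/= scaler0 addr0 | exact: cst_continuous].
move=> a f g /cont_linearP[lf cf] /cont_linearP[lg cg]; apply/cont_linearP.
split=> [b x y|x].
  rewrite !fctE lf lg !scalerDr !scalerA (mulrC a b) -!addrA; congr (_ + _).
  by rewrite addrCA.
by apply: cvgD; [apply: cvgZl_tmp; exact: cf | exact: cg].
Qed.

HB.instance Definition _ :=
  GRing.isSubmodClosed.Build R (E -> F) cont_linear cont_linear_submod_closed.

Record clin := CLin {
  clin_fun :> E -> F ;
  clin_subproof : clin_fun \in cont_linear }.

HB.instance Definition _ := [isSub for clin_fun].
HB.instance Definition _ := [Choice of clin by <:].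
HB.instance Definition _ := [SubChoice_isSubLmodule of clin by <:].

(* The library has no operator norm: [clin] is the normed space L(E, F). *)
Definition opnorm (u : clin) : R :=
  sup [set `|u x| | x in [set x : E | `|x| <= 1]].

Lemma clin_bounded (u : clin) : exists M, forall x, `|x| <= 1 -> `|u x| <= M.
Proof.
have [lu cu] := cont_linearP _ (clin_subproof u).
pose g : {linear E -> F} :=
  HB.pack (clin_fun u) (GRing.isLinear.Build _ _ _ _ _ lu).
have /bounded_funP/(_ 1) // : bounded_near g (nbhs (0 : E)).
by apply/linear_bounded_continuous.
Qed.

Lemma opnorm_has_sup (u : clin) :
  has_sup [set `|u x| | x in [set x : E | `|x| <= 1]].
Proof.
split; first by exists `|u 0|, 0 => //=; rewrite normr0 ler01.
by have [M uM] := clin_bounded u; exists M => _ [x x1 <-]; exact: uM.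
Qed.

Lemma opnorm_ub (u : clin) x : `|x| <= 1 -> `|u x| <= opnorm u.
Proof. by move=> x1; apply: sup_upper_bound (opnorm_has_sup u) _ _; exists x. Qed.

Lemma opnorm_le (u : clin) M :
  (forall x, `|x| <= 1 -> `|u x| <= M) -> opnorm u <= M.
Proof.
move=> uM; apply: ge_sup; first by case: (opnorm_has_sup u).
by move=> _ [x x1 <-]; exact: uM.
Qed.

Lemma opnormD (u v : clin) : opnorm (u + v) <= opnorm u + opnorm v.
Proof.
apply: opnorm_le => x x1.
by rewrite (le_trans (ler_normD _ _)) ?lerD ?opnorm_ub.
Qed.

Lemma opnormZ_le a (u : clin) : opnorm (a *: u) <= `|a| * opnorm u.
Proof.
by apply: opnorm_le => x x1; rewrite [leLHS]normrZ ler_wpM2l ?opnorm_ub.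
Qed.

Lemma opnormZ a (u : clin) : opnorm (a *: u) = `|a| * opnorm u.
Proof.
apply/eqP; rewrite eq_le opnormZ_le /=.
have [->|a0] := eqVneq a 0.
  rewrite normr0 mul0r; have h := @opnorm_ub (0 *: u) 0.
  by apply: le_trans (normr_ge0 _) (h _); rewrite normr0 ler01.
rewrite -ler_pdivlMl ?normr_gt0// -normfV -[in leLHS](scalerK a0 u).
exact: opnormZ_le.
Qed.

Lemma opnorm0_eq0 (u : clin) : opnorm u = 0 -> u = 0.
Proof.
move=> u0; apply/val_inj/funext => x /=.
have [lu _] := cont_linearP _ (clin_subproof u).
have u00 : u 0 = 0.
  by have := lu (-1) 0 0; rewrite !scaleN1r addrC oppr0 addr0 subrr.
have [->|x0] := eqVneq x 0; first exact: u00.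
have nx : 0 < `|x| by rewrite normr_gt0.
have : `|u (`|x|^-1 *: x)| <= 0.
  by rewrite -u0 opnorm_ub// normrZ normfV normr_id mulVf ?gt_eqF.
rewrite normr_le0 -[_ *: x]addr0 lu u00 addr0 scaler_eq0 invr_eq0 (gt_eqF nx)/=.
by move/eqP.
Qed.

HB.instance Definition _ :=
  Lmodule_isNormed.Build R clin opnormD opnormZ opnorm0_eq0.

End continuous_linear_maps.
Arguments clin {R} E F.

Section smooth_maps.
Context {R : realType}.

(* f is n times continuously Fréchet differentiable on A, which is always an open
   set in the sequel. *)
Fixpoint Cn (n : nat) (E F : normedModType R) (A : set E) (f : E -> F) : Prop :=
  match n with
  | 0 => forall x, A x -> {for x, continuous f}
  | n'.+1 => exists2 f' : E -> clin E F,
      (forall x, A x -> is_diff x f (f' x)) & Cn n' A f'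
  end.

Definition smooth_on (E F : normedModType R) (A : set E) (f : E -> F) : Prop :=
  forall n, Cn n A f.

Lemma smooth_on_cst (E F : normedModType R) (A : set E) (c : F) :
  smooth_on A (fun=> c).
Proof.
move=> n; elim: n F c => [|n IHn] F c /=; first by move=> x _; exact: cst_continuous.
by exists (fun=> 0) => [x _|]; [exact: is_diff_cst | exact: IHn].
Qed.

End smooth_maps.

Section manifolds.
Context {R : realType}.

(* Only the data: see [is_manifold].  [chart a] is meaningful on [dom a] only. *)
Record atlas (E : normedModType R) := Atlas {
  pt :> Type ;
  idx : Type ;
  dom : idx -> set pt ;
  chart : idx -> pt -> E }.

(* Here and below a map f on a part U of the domain of [chart a] is read in that
   chart by giving a map s on the model space with f x = s (chart a x) for x in U:
   as the chart is injective there, s is f \o (chart a)^-1 on chart a @` U. *)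

(* Lang's definition of a smooth manifold by an atlas; no separation axiom. *)
Definition is_manifold (E : normedModType R) (M : atlas E) : Prop :=
  [/\ forall x : M, exists a : idx M, dom a x,
      forall (a : idx M) (x y : M),
        dom a x -> dom a y -> chart a x = chart a y -> x = y,
      forall a b : idx M, open (chart a @` (dom a `&` dom b)) &
      forall a b : idx M, exists2 s : E -> E,
        smooth_on (chart b @` (dom a `&` dom b)) s &
        forall x, (dom a `&` dom b) x -> chart a x = s (chart b x)].

(* A is open in M, for the topology for which the charts are homeomorphisms. *)
Definition mopen (E : normedModType R) (M : atlas E) (A : set M) : Prop :=
  forall a : idx M, open (chart a @` (dom a `&` A)).

(* The set A on which g is smooth is required to be open in M. *)
Definition msmooth_on (E G : normedModType R) (M : atlas E)
    (A : set M) (g : M -> G) : Prop :=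
  mopen A /\
  forall a : idx M, exists2 s : E -> G,
    smooth_on (chart a @` (dom a `&` A)) s &
    forall x, (dom a `&` A) x -> g x = s (chart a x).

Definition smooth_map (E F : normedModType R) (M : atlas E) (N : atlas F)
    (h : M -> N) : Prop :=
  forall (a : idx M) (b : idx N),
    open (chart a @` (dom a `&` h @^-1` dom b)) /\
    exists2 s : E -> F,
      smooth_on (chart a @` (dom a `&` h @^-1` dom b)) s &
      forall x, (dom a `&` h @^-1` dom b) x -> chart b (h x) = s (chart a x).

Definition smooth_curve_on (E : normedModType R) (M : atlas E)
    (J : set R) (f : R -> M) : Prop :=
  forall a : idx M,
    open (J `&` f @^-1` dom a) /\
    smooth_on (J `&` f @^-1` dom a) (chart a \o f).

Definition is_curve (E : normedModType R) (M : atlas E) (f : R -> M) : Prop :=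
  exists2 e : R, 0 < e & smooth_curve_on `](- e), e[ f.

(* Smooth curves ]-e, e[ -> M for some e > 0, extended arbitrarily to a function
   on R; the equivalence relations below only see the values near 0. *)
Record curve (E : normedModType R) (M : atlas E) := Curve {
  curve_fun :> R -> M ;
  curveP : is_curve curve_fun }.

HB.instance Definition _ (E : normedModType R) (M : atlas E) :=
  gen_eqMixin (curve M).
HB.instance Definition _ (E : normedModType R) (M : atlas E) :=
  gen_choiceMixin (curve M).

Lemma is_curve_cst (E : normedModType R) (M : atlas E) (x : M) :
  is_curve (fun=> x).
Proof.
exists 1 => // a; split; last exact: smooth_on_cst.
have [ax|ax] := pselect (dom a x).
  rewrite (_ : _ @^-1` _ = setT) ?setIT; last by apply/seteqP; split.
  exact: interval_open.
rewrite (_ : _ @^-1` _ = set0) ?setI0; first exact: open0.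
by apply/seteqP; split.
Qed.

Definition cst_curve (E : normedModType R) (M : atlas E) (x : M) : curve M :=
  Curve (is_curve_cst x).

End manifolds.

Section tangent_bundle.
Context {R : realType} {E : normedModType R} (M : atlas E).

Definition tangent_eq (c d : curve M) : bool :=
  `[< c 0 = d 0 /\
      forall a : idx M, dom a (c 0) ->
        derive1 (chart a \o c) 0 = derive1 (chart a \o d) 0 >].

Lemma tangent_eq_equiv : equiv_class_of tangent_eq.
Proof.
split=> [c|c d|d c e].
- exact/asboolP.
- apply/asboolP/asboolP => -[cd0 cd1]; (split; first by rewrite cd0);
    by move=> a adc; rewrite cd1// ?cd0// -?cd0.
- move=> /asboolP[cd0 cd1] /asboolP[de0 de1]; apply/asboolP.
  split; first by rewrite cd0.
  by move=> a ac; rewrite cd1// de1// -cd0.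
Qed.

Canonical tangent_equiv := EquivRelPack tangent_eq_equiv.

Definition TM := {eq_quot tangent_equiv}.

Definition tproj (v : TM) : M := repr v 0.

Definition tcoord (a : idx M) (v : TM) : E := derive1 (chart a \o repr v) 0.

Definition tangent : atlas (E * E)%type := {|
  pt := TM ;
  idx := idx M ;
  dom := fun a => tproj @^-1` dom a ;
  chart := fun a v => (chart a (tproj v), tcoord a v) |}.

(* f'(t) = [df(t)](1), the class of s |-> f (t + s).  When f is not smooth near t
   this is the junk value 0; a smooth curve ]-e, e[ -> M never meets this case. *)
Definition velocity (f : R -> M) (t : R) : tangent :=
  if pselect (is_curve (fun s => f (t + s))) is left h
  then \pi_TM (Curve h) else \pi_TM (cst_curve (f t)).

End tangent_bundle.
Arguments tproj {R E} M v.

Section second_order_tangent_bundle.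
Context {R : realType} {E : normedModType R} (M : atlas E).

(* f'(0) = g'(0) in TM and f''(0) = g''(0) in T(TM); the first equation contains
   f(0) = g(0), so that the union of the T^2_x M is a quotient of all curves. *)
Definition second_order_eq (f g : curve M) : bool :=
  `[< velocity f 0 = velocity g 0 /\
      velocity (velocity f) 0 = velocity (velocity g) 0 >].

Lemma second_order_eq_equiv : equiv_class_of second_order_eq.
Proof.
split=> [f|f g|g f h].
- exact/asboolP.
- by apply/asboolP/asboolP => -[-> ->].
- by move=> /asboolP[fg1 fg2] /asboolP[gh1 gh2]; apply/asboolP; rewrite fg1 fg2.
Qed.

Canonical second_order_equiv := EquivRelPack second_order_eq_equiv.

Definition T2M := {eq_quot second_order_equiv}.

Definition proj2M (v : T2M) : M := repr v 0.

(* The natural smooth structure of T^2 M: [f, x]_2 has the coordinates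
   (psi x, (psi \o f)'(0), (psi \o f)''(0)) in the chart induced by psi. *)
Definition tangent2 : atlas (E * (E * E))%type := {|
  pt := T2M ;
  idx := idx M ;
  dom := fun a => proj2M @^-1` dom a ;
  chart := fun a v => (chart a (proj2M v),
    (derive1 (chart a \o repr v) 0, derive1n 2 (chart a \o repr v) 0)) |}.

End second_order_tangent_bundle.
Arguments proj2M {R E} M v.

Section vector_bundles.
Context {R : realType}.

(* The data of a trivializing cover of p : X -> M, with fibers of type F:
   [triv j] is the second component of the j-th trivialization, over [vdom j]. *)
Record vbundle (E : normedModType R) (M : atlas E) (X : Type) (p : X -> M)
    (F : normedModType R) := VBundle {
  vidx : Type ;
  vdom : vidx -> set M ;
  triv : vidx -> X -> F }.

(* The vector space structure of the fibers is the one carried over by the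
   trivializations.  The transition maps are invertible: exchange j and k. *)
Definition is_vbundle (E : normedModType R) (M : atlas E) (X : Type)
    (p : X -> M) (F : normedModType R) (V : vbundle p F) : Prop :=
  [/\ forall x : M, exists j : vidx V, vdom j x,
      forall j : vidx V, mopen (vdom j),
      forall (j : vidx V) (x : M),
        vdom j x -> set_bij [set v | p v = x] setT (triv j) &
      forall j k : vidx V, exists2 g : M -> clin F F,
        msmooth_on (vdom j `&` vdom k) g &
        forall v, (vdom j `&` vdom k) (p v) -> triv k v = g (p v) (triv j v)].

(* The smooth structure on the total space determined by the bundle. *)
Definition vtotal (E : normedModType R) (M : atlas E) (X : Type)
    (p : X -> M) (F : normedModType R) (V : vbundle p F) :
  atlas (E * F)%type := {|
  pt := X ;
  idx := idx M * vidx V ;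
  dom := fun aj => p @^-1` (dom aj.1 `&` vdom aj.2) ;
  chart := fun aj v => (chart aj.1 (p v), triv aj.2 v) |}.

(* A vector bundle structure on the manifold X over M: a vector bundle whose
   total space has the given smooth structure of X. *)
Definition smooth_vbundle (E G : normedModType R) (M : atlas E) (X : atlas G)
    (p : X -> M) (F : normedModType R) (V : vbundle p F) : Prop :=
  [/\ is_vbundle V,
      @smooth_map _ _ _ X (vtotal V) id &
      @smooth_map _ _ _ (vtotal V) X id].

Definition vb_morphism (E E' : normedModType R) (M : atlas E) (M' : atlas E')
    (X X' : Type) (p : X -> M) (p' : X' -> M') (F F' : normedModType R)
    (V : vbundle p F) (V' : vbundle p' F') (h0 : M -> M') (h : X -> X') : Prop :=
  [/\ smooth_map h0,
      forall v, p' (h v) = h0 (p v) &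
      forall x : M, exists (j : vidx V) (k : vidx V'),
        [/\ vdom j x, vdom k (h0 x) &
        exists2 g : M -> clin F F',
          msmooth_on (vdom j `&` h0 @^-1` vdom k) g &
          forall v, (vdom j `&` h0 @^-1` vdom k) (p v) ->
            triv k (h v) = g (p v) (triv j v)]].

Definition vb_isomorphic (E : normedModType R) (M : atlas E)
    (X X' : Type) (p : X -> M) (p' : X' -> M) (F F' : normedModType R)
    (V : vbundle p F) (V' : vbundle p' F') : Prop :=
  exists (h : X -> X') (h' : X' -> X),
    [/\ vb_morphism V V' id h, vb_morphism V' V id h', cancel h h' & cancel h' h].

Definition fib_prod (M : Type) (X X' : Type) (p : X -> M) (p' : X' -> M) : Type :=
  {v : X * X' | p v.1 = p' v.2}.

Definition fib_proj (M : Type) (X X' : Type) (p : X -> M) (p' : X' -> M)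
  (v : fib_prod p p') : M := p (sval v).1.

Definition vb_prod (E : normedModType R) (M : atlas E)
    (X X' : Type) (p : X -> M) (p' : X' -> M) (F F' : normedModType R)
    (V : vbundle p F) (V' : vbundle p' F') :
  vbundle (@fib_proj M X X' p p') (F * F')%type := {|
  vidx := vidx V * vidx V' ;
  vdom := fun jk => vdom jk.1 `&` vdom jk.2 ;
  triv := fun jk v => (triv jk.1 (sval v).1, triv jk.2 (sval v).2) |}.

Definition tangent_vb (E : normedModType R) (M : atlas E) :
  vbundle (tproj M) E := {|
  vidx := idx M ;
  vdom := @dom R E M ;
  triv := @tcoord R E M |}.

End vector_bundles.
Arguments smooth_vbundle {R E G M} X {p F} V.

Section connections.
Context {R : realType} {E : normedModType R} (M : atlas E).

Definition local_form (D : tangent (tangent M) -> tangent M) (a : idx M)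
    (w : E * E -> clin E E) : Prop :=
  smooth_on ((chart a @` dom a) `*` setT) w /\
  forall z : tangent (tangent M), @dom _ _ (tangent (tangent M)) a z ->
    let: ((y, u), (v, r)) := @chart _ _ (tangent (tangent M)) a z in
    @chart _ _ (tangent M) a (D z) = (y, r + w (y, u) v).

(* D is a vector bundle morphism from pi_TM : T(TM) -> TM to pi_M : TM -> M,
   over pi_M. *)
Definition connection (D : tangent (tangent M) -> tangent M) : Prop :=
  vb_morphism (tangent_vb (tangent M)) (tangent_vb M) (tproj M) D /\
  forall a : idx M, exists w : E * E -> clin E E, local_form D a w.

(* Only the values of w (y, _) for y in the image of the chart are determined
   by D. *)
Definition linear_connection (D : tangent (tangent M) -> tangent M) : Prop :=
  connection D /\
  forall (a : idx M) (w : E * E -> clin E E), local_form D a w ->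
    forall y, (chart a @` dom a) y -> linear (fun u => w (y, u)).

End connections.

(* Main.v *)
Require Import Defs.
From HB Require Import structures.
From mathcomp Require Import all_boot all_order all_algebra.
From mathcomp Require Import all_classical all_reals all_analysis.
From mathcomp Require Import ring.
Set Implicit Arguments.
Unset Strict Implicit.
Unset Printing Implicit Defensive.
Import Order.TTheory GRing.Theory Num.Theory.
Import numFieldNormedType.Exports.
Local Open Scope classical_set_scope.
Local Open Scope quotient_scope.
Local Open Scope ring_scope.

(** Read in a chart psi, an element [f, x]_2 of T^2 M has the fibre coordinates
    (u, c) = ((psi o f)'(0), (psi o f)''(0)), and a change of charts sigma acts by
      (u, c) |-> (sigma' u, sigma' c + sigma''(u, u)).
    The quadratic term that distinguishes T^2 M from TM x TM is precisely the
    inhomogeneous term in the transformation law of Christoffel symbols, so an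
    identification of T^2 M with TM x TM should produce a connection.

    The isomorphism h : T^2 M -> TM x TM and its inverse are fibre preserving and
    smooth; in a chart a they become maps H_a(y), K_a(y) of E x E, inverse to each
    other and depending smoothly on y (forward_local_form, backward_local_form),
    and a change of charts gives (H_change)
      H_b (sigma' u, sigma' c + sigma''(u, u)) = (sigma' (+) sigma') H_a (u, c).
    The linear structure of the fibres of T^2 M is the one carried over by the
    trivializations of V, so H_a(y) is in general not linear in the coordinates
    (u, c). The zero vector, the class of the constant curve, is however fixed by
    all coordinate changes, and two derivatives of the identity at it give
      D^2 H_b (sigma' u, sigma' v) + D H_b (0, 2 sigma''(u, v))
        = (sigma' (+) sigma') D^2 H_a (u, v),
    where u stands for (u, 0) and v for (v, 0). Hence
      Gamma_a (u, v) = second component of D K_a (H_a 0) (1/2 D^2 H_a (u, v))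
    satisfies the transformation law (second_derivative_conjugate,
    christoffel_law, christoffel_map_law). The symmetry of sigma'' that is used
    here is Schwarz's theorem, second_derivative_symmetric, which follows from the
    mean value inequality.

    Gamma_a is smooth in y and bilinear. On a vector of T(TM) with coordinates
    (y, u, v, r) the connection has the value with coordinates
    (y, r + Gamma_a (u, v)); by the transformation law this does not depend on the
    chart (connection_vector). The passage between charts and points rests on the
    coordinate changes on TM, T^2 M and T(TM) and on the existence of curves with
    prescribed derivatives (exists_curve_in_chart); smoothness statements rest on
    a calculus of germs of smooth maps between normed spaces (smooth_at), in which
    every derivative is built from bounded bilinear operations. *)

(** * Continuous linear maps and their bilinear operations *)

HB.lock Definition mk_clin (R : realType) (E F : normedModType R) (f : E -> F) :
    clin E F :=
  if pselect (f \in cont_linear) is left h then CLin h else 0.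

(** The differential as an element of L(E, F), so that it can be differentiated
    again. It is locked because comparing two different differentials up to
    conversion would otherwise unfold the choice operator that defines 'd. *)
HB.lock Definition dclin (R : realType) (E F : normedModType R) (f : E -> F) (x : E) :
    clin E F :=
  mk_clin ('d f x).

Section clin_theory.
Context {R : realType}.
Implicit Types E F G : normedModType R.

Lemma clin_linear E F (u : clin E F) : linear u.
Proof. by case: (cont_linearP _ (clin_subproof u)). Qed.

HB.instance Definition _ E F (u : clin E F) :=
  GRing.isLinear.Build R E F *:%R (clin_fun u) (@clin_linear E F u).

Lemma clin_continuous E F (u : clin E F) : continuous u.
Proof. by case: (cont_linearP _ (clin_subproof u)). Qed.

Lemma clin_ext E F (u v : clin E F) : u =1 v -> u = v.
Proof. by move=> uv; apply/val_inj/funext. Qed.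

Lemma clin_addE E F (u v : clin E F) x : (u + v) x = u x + v x.
Proof. by []. Qed.

Lemma clin_scaleE E F k (u : clin E F) x : (k *: u) x = k *: u x.
Proof. by []. Qed.

Lemma clinD E F (u : clin E F) x y : u (x + y) = u x + u y.
Proof. by rewrite linearD. Qed.

Lemma clinZ E F (u : clin E F) k x : u (k *: x) = k *: u x.
Proof. by rewrite linearZ. Qed.

Lemma clin_oppE E F (u : clin E F) x : (- u) x = - u x.
Proof. by []. Qed.

Lemma clin_norm_le E F (u : clin E F) x : `|u x| <= `|u| * `|x|.
Proof.
have [->|x0] := eqVneq x 0; first by rewrite linear0 !normr0 mulr0.
have nx : 0 < `|x| by rewrite normr_gt0.
have : `|u (`|x|^-1 *: x)| <= `|u|.
  by apply: opnorm_ub; rewrite normrZ normfV normr_id mulVf ?gt_eqF.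
by rewrite linearZ normrZ normfV normr_id ler_pdivrMl// mulrC.
Qed.

Lemma clin_norm_ge E F (u : clin E F) C :
  0 <= C -> (forall x, `|u x| <= C * `|x|) -> `|u| <= C.
Proof.
move=> C0 uC; apply: opnorm_le => x x1; apply: le_trans (uC x) _.
by rewrite -[leRHS]mulr1 ler_wpM2l.
Qed.

Lemma mk_clinE E F (f : E -> F) : linear f -> continuous f -> mk_clin f = f :> (E -> F).
Proof.
move=> lf cf; rewrite mk_clin.unlock; case: pselect => //.
by case; apply/cont_linearP.
Qed.

Lemma mk_clin_boundedE E F (f : E -> F) (C : R) : linear f ->
  (forall x, `|f x| <= C * `|x|) -> mk_clin f = f :> (E -> F).
Proof.
move=> lf fC; apply: mk_clinE => //.
pose g : {linear E -> F} := HB.pack f (GRing.isLinear.Build _ _ _ _ _ lf).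
change (continuous g); apply/linear_bounded_continuous/bounded_funP => r.
exists (`|C| * r) => x xr; apply: le_trans (fC x) _.
by rewrite (le_trans (ler_wpM2r _ (ler_norm C)))// ler_wpM2l.
Qed.

(** Landau's notation is replaced here once and for all by inequalities: locality
    of the differential, the bilinear rule and the second difference estimate
    below are proved from this form. *)
Lemma is_diff_normP E F (f : E -> F) x (u : clin E F) : is_diff x f u <->
  forall e : R, 0 < e ->
    \forall h \near (0 : E), `|f (h + x) - (f x + u h)| <= e * `|h|.
Proof.
split.
  by case=> + du => /diff_locally/eqaddoP; rewrite du.
move=> H; have H' : f \o shift x = cst (f x) + (u : {linear E -> F}) +o_ 0 id.
  by apply/eqaddoP.
have cu : continuous (u : {linear E -> F}) by exact: clin_continuous.
have du := diff_unique cu H'.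
by apply: DiffDef => //; apply/diff_locallyP; rewrite du.
Qed.

Lemma dclin_diff E F (f : E -> F) x : differentiable f x ->
  dclin f x = 'd f x :> (E -> F).
Proof.
by move=> df; rewrite dclin.unlock mk_clinE//; [exact: linearP|exact: diff_continuous].
Qed.

Lemma dclinP E F (f : E -> F) x : differentiable f x -> is_diff x f (dclin f x).
Proof. by move=> df; apply: DiffDef; rewrite ?dclin_diff. Qed.

Lemma dclin_val E F (f : E -> F) x (u : clin E F) : is_diff x f u -> dclin f x = u.
Proof. by case=> df du; apply: clin_ext => h; rewrite dclin_diff// du. Qed.

Lemma is_diff_near E F (f g : E -> F) x (u : clin E F) :
  (\forall y \near x, f y = g y) -> is_diff x f u -> is_diff x g u.
Proof.
move=> fg /is_diff_normP H; apply/is_diff_normP => e e0.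
have := H e e0; move: (fg) => /nbhs0P; rewrite (nbhs_singleton fg).
by apply: filterS2 => h; rewrite (addrC x) => ->.
Qed.

Lemma clin_is_diff E F (u : clin E F) x : is_diff x u u.
Proof.
apply/is_diff_normP => e e0; near=> h.
by rewrite linearD [u x + _]addrC subrr normr0 mulr_ge0// ltW.
Unshelve. all: by end_near. Qed.

End clin_theory.

Section bounded_bilinear.
Context {R : realType}.
Implicit Types E F G H : normedModType R.

(** Evaluation and composition of continuous linear maps are bounded bilinear;
    every derivative met below is built from such operations, so that one
    product rule proves all smoothness statements. *)
Record bounded_bilinear F G H (B : F -> G -> H) : Prop := BoundedBilinear {
  bilinl : forall y, linear (B ^~ y) ;
  bilinr : forall x, linear (B x) ;
  bilin_bound : exists2 C, 0 <= C & forall x y, `|B x y| <= C * `|x| * `|y| }.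

Lemma linear_fun0 F G (f : F -> G) : linear f -> f 0 = 0.
Proof. by move=> lf; have := lf (-1) 0 0; rewrite scaler0 addr0 scaleN1r addNr. Qed.

Lemma linear_funD F G (f : F -> G) x y : linear f -> f (x + y) = f x + f y.
Proof. by move=> lf; have := lf 1 x y; rewrite !scale1r. Qed.

(** The derivative of B (f, g) is clin_compl B f' g + clin_compr B f g', and both
    operations are again bounded bilinear: this is what makes the induction in
    Cn_bilinear go through. *)
Definition clin_compl E F G H (B : F -> G -> H) (u : clin E F) (y : G) : clin E H :=
  mk_clin (fun x => B (u x) y).
Definition clin_compr E F G H (B : F -> G -> H) (x : F) (u : clin E G) : clin E H :=
  mk_clin (fun y => B x (u y)).

Lemma clin_complE E F G H (B : F -> G -> H) (u : clin E F) y x :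
  bounded_bilinear B -> clin_compl B u y x = B (u x) y.
Proof.
case=> Bl Br [C C0 BC]; rewrite /clin_compl (@mk_clin_boundedE _ _ _ _ (C * `|y| * `|u|))//.
  by move=> a z t; rewrite linearP Bl.
move=> z; apply: le_trans (BC _ _) _.
by rewrite mulrAC -!mulrA ler_wpM2l// ler_wpM2l// clin_norm_le.
Qed.

Lemma clin_comprE E F G H (B : F -> G -> H) x (u : clin E G) y :
  bounded_bilinear B -> clin_compr B x u y = B x (u y).
Proof.
case=> Bl Br [C C0 BC]; rewrite /clin_compr (@mk_clin_boundedE _ _ _ _ (C * `|x| * `|u|))//.
  by move=> a z t; rewrite linearP Br.
move=> z; apply: le_trans (BC _ _) _.
by rewrite -!mulrA ler_wpM2l// ler_wpM2l// clin_norm_le.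
Qed.

Lemma bounded_bilinear_compl E F G H (B : F -> G -> H) :
  bounded_bilinear B -> bounded_bilinear (@clin_compl E _ _ _ B).
Proof.
move=> hB; have [Bl Br [C C0 BC]] := hB; split.
- move=> y a u v; apply: clin_ext => x.
  by rewrite clin_addE clin_scaleE !clin_complE// clin_addE clin_scaleE Bl.
- move=> u a y z; apply: clin_ext => x.
  by rewrite clin_addE clin_scaleE !clin_complE// Br.
- exists C => // u y; apply: clin_norm_ge; first by rewrite !mulr_ge0.
  move=> x; rewrite clin_complE//; apply: le_trans (BC _ _) _.
  by rewrite mulrAC -!mulrA ler_wpM2l// mulrCA ler_wpM2l// clin_norm_le.
Qed.

Lemma bounded_bilinear_compr E F G H (B : F -> G -> H) :
  bounded_bilinear B -> bounded_bilinear (@clin_compr E _ _ _ B).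
Proof.
move=> hB; have [Bl Br [C C0 BC]] := hB; split.
- move=> u a y z; apply: clin_ext => x.
  by rewrite clin_addE clin_scaleE !clin_comprE// Bl.
- move=> y a u v; apply: clin_ext => x.
  by rewrite clin_addE clin_scaleE !clin_comprE// clin_addE clin_scaleE Br.
- exists C => // y u; apply: clin_norm_ge; first by rewrite !mulr_ge0.
  move=> x; rewrite clin_comprE//; apply: le_trans (BC _ _) _.
  by rewrite -!mulrA ler_wpM2l// ler_wpM2l// clin_norm_le.
Qed.

Definition clin_eval F G (u : clin F G) (x : F) : G := u x.
Definition clin_comp F G H (u : clin G H) (v : clin F G) : clin F H :=
  mk_clin (u \o v).

Lemma clin_compE F G H (u : clin G H) (v : clin F G) x :
  clin_comp u v x = u (v x).
Proof.
rewrite /clin_comp (@mk_clin_boundedE _ _ _ _ (`|u| * `|v|))//.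
  by move=> a z t; rewrite /= !linearP.
move=> z /=; apply: le_trans (clin_norm_le _ _) _.
by rewrite -mulrA ler_wpM2l// clin_norm_le.
Qed.

Lemma bounded_bilinear_eval F G : bounded_bilinear (@clin_eval F G).
Proof.
split; [by []|by move=> x; exact: linearP|exists 1 => // u x].
by rewrite mul1r clin_norm_le.
Qed.

Lemma bounded_bilinear_comp F G H : bounded_bilinear (@clin_comp F G H).
Proof.
split.
- by move=> v a u w; apply: clin_ext => x;
    rewrite clin_addE clin_scaleE !clin_compE.
- by move=> u a v w; apply: clin_ext => x;
    rewrite clin_addE clin_scaleE !clin_compE clin_addE clin_scaleE linearP.
- exists 1 => // u v; apply: clin_norm_ge; first by rewrite !mulr_ge0.
  move=> x; rewrite clin_compE mul1r; apply: le_trans (clin_norm_le _ _) _.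
  by rewrite -mulrA ler_wpM2l// clin_norm_le.
Qed.

Lemma bounded_bilinear_scale F : bounded_bilinear (fun (k : R) (x : F) => k *: x).
Proof.
split.
- by move=> x a k l; rewrite scalerDl scalerA.
- by move=> k a x y; rewrite scalerDr !scalerA mulrC.
- by exists 1 => // k x; rewrite mul1r normrZ.
Qed.

Definition clin_fst F G : clin (F * G)%type F := mk_clin fst.
Definition clin_snd F G : clin (F * G)%type G := mk_clin snd.
Definition clin_inl F G : clin F (F * G)%type := mk_clin (fun x => (x, 0)).
Definition clin_inr F G : clin G (F * G)%type := mk_clin (fun y => (0, y)).
Definition clin_id F : clin F F := mk_clin id.

Lemma clin_fstE F G : clin_fst F G = fst :> (_ -> _).
Proof.
by rewrite /clin_fst (@mk_clin_boundedE _ _ _ _ 1)// => x; rewrite mul1r le_max lexx.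
Qed.

Lemma clin_sndE F G : clin_snd F G = snd :> (_ -> _).
Proof.
by rewrite /clin_snd (@mk_clin_boundedE _ _ _ _ 1)// => x; rewrite mul1r le_max lexx orbT.
Qed.

Lemma clin_inlE F G : clin_inl F G = (fun x => (x, 0)) :> (_ -> _).
Proof.
rewrite /clin_inl (@mk_clin_boundedE _ _ _ _ 1)//.
  by move=> a x y; congr (_, _); rewrite /= scaler0 addr0.
by move=> x; rewrite mul1r ge_max lexx normr0 /=.
Qed.

Lemma clin_inrE F G : clin_inr F G = (fun x => (0, x)) :> (_ -> _).
Proof.
rewrite /clin_inr (@mk_clin_boundedE _ _ _ _ 1)//.
  by move=> a x y; congr (_, _); rewrite /= scaler0 addr0.
by move=> x; rewrite mul1r ge_max lexx normr0 /= normr_ge0.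
Qed.

Lemma clin_idE F : clin_id F = id :> (_ -> _).
Proof. by rewrite /clin_id (@mk_clin_boundedE _ _ _ _ 1)// => x; rewrite mul1r. Qed.

Definition clin_line F (v : F) : clin R F := mk_clin (fun t : R => t *: v).

Lemma clin_lineE F (v : F) t : clin_line v t = t *: v.
Proof.
rewrite /clin_line (@mk_clin_boundedE _ _ _ _ `|v|)//.
  by move=> a x y; rewrite scalerDl scalerA.
by move=> x; rewrite normrZ mulrC.
Qed.

Definition clin_diag E (T : clin E E) : clin (E * E)%type (E * E)%type :=
  mk_clin (fun p => (T p.1, T p.2)).

Lemma clin_diagE E (T : clin E E) p : clin_diag T p = (T p.1, T p.2).
Proof.
rewrite /clin_diag mk_clinE//.
  by move=> a x y; congr (_, _); rewrite /= linearP.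
move=> q; apply: cvg_pair; apply: continuous_comp; try exact: clin_continuous.
  exact: cvg_fst.
exact: cvg_snd.
Qed.

(** The remainder of B at p in the direction h is exactly B h.1 h.2, which is
    bounded by C |h|^2. *)
Lemma is_diff_bilinear_pair F G H (B : F -> G -> H) : bounded_bilinear B ->
  forall p : F * G,
  is_diff p (fun q => B q.1 q.2)
    (clin_compr B p.1 (clin_snd F G) + clin_compl B (clin_fst F G) p.2 : clin _ _).
Proof.
move=> hB p; have [Bl Br [C C0 BC]] := hB.
apply/is_diff_normP => e e0.
have C1 : 0 < C + 1 by rewrite ltr_wpDl.
have small : \forall h \near (0 : (F * G)%type), `|h| <= (C + 1)^-1 * e.
  by apply: nbhs0_le; rewrite mulr_gt0// invr_gt0.
near=> h.
rewrite clin_addE clin_comprE// clin_complE// clin_fstE clin_sndE.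
rewrite (linear_funD _ _ (Bl _)) !(linear_funD _ _ (Br _)).
rewrite (_ : _ - _ = B h.1 h.2); last first.
  apply/eqP; rewrite subr_eq; apply/eqP.
  rewrite -addrA; congr (_ + _).
  by rewrite addrA addrC; congr (_ + _); exact: addrC.
apply: le_trans (BC _ _) _.
have h1 : `|h.1| <= `|h| by rewrite le_max lexx.
have h2 : `|h.2| <= `|h| by rewrite le_max lexx orbT.
rewrite ler_pM ?mulr_ge0//.
rewrite (@le_trans _ _ ((C + 1) * `|h|))// ?ler_pM ?lerDl//.
rewrite -ler_pdivlMl//.
by near: h.
Unshelve. all: by end_near. Qed.

Lemma is_diff_bilinear E F G H (B : F -> G -> H) (f : E -> F) (g : E -> G) x
    (u : clin E F) (v : clin E G) : bounded_bilinear B ->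
  is_diff x f u -> is_diff x g v ->
  is_diff x (fun y => B (f y) (g y)) (clin_compl B u (g x) + clin_compr B (f x) v : clin _ _).
Proof.
move=> hB fu gv.
have := is_diff_comp (is_diff_pair fu gv) (is_diff_bilinear_pair hB (f x, g x)).
congr is_diff_def; apply/funext => h; rewrite /comp.
rewrite !clin_addE !clin_comprE// !clin_complE// clin_fstE clin_sndE /=.
by rewrite addrC.
Qed.

End bounded_bilinear.

(** * Calculus of smooth maps between normed spaces *)

Section smooth_calculus.
Context {R : realType}.
Implicit Types E F G H : normedModType R.

Lemma is_diff_clinD E F (f g : E -> F) x (u v : clin E F) :
  is_diff x f u -> is_diff x g v -> is_diff x (fun y => f y + g y) (u + v : clin E F).
Proof. exact: is_diffD. Qed.

Lemma is_diff_clin_comp E F G (f : E -> F) (g : F -> G) x (u : clin E F) (v : clin F G) :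
  is_diff x f u -> is_diff (f x) g v -> is_diff x (g \o f) (clin_comp v u).
Proof.
move=> fu gv; have := is_diff_comp fu gv; congr is_diff_def.
by apply/funext => h; rewrite clin_compE.
Qed.

Lemma Cn_subset n E F (A B : set E) (f : E -> F) :
  A `<=` B -> Cn n B f -> Cn n A f.
Proof.
elim: n F f => [|n IHn] F f AB /=; first by move=> Bf x /AB; exact: Bf.
by case=> f' ff' Cf'; exists f' => [x /AB|]; [exact: ff'|exact: IHn Cf'].
Qed.

Lemma Cn_continuous n E F (A : set E) (f : E -> F) :
  Cn n A f -> forall x, A x -> {for x, continuous f}.
Proof.
case: n => [//|n] [f' ff' _] x /ff'[df _]; exact: differentiable_continuous.
Qed.

Lemma CnW n E F (A : set E) (f : E -> F) : Cn n.+1 A f -> Cn n A f.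
Proof.
elim: n F f => [|n IHn] F f; first by move=> /Cn_continuous.
by case=> f' ff' /IHn; exists f'.
Qed.

Lemma Cn_eq n E F (A : set E) (f g : E -> F) : open A ->
  (forall x, A x -> f x = g x) -> Cn n A f -> Cn n A g.
Proof.
move=> oA fg.
have near_fg x : A x -> \forall y \near x, f y = g y.
  by move=> Ax; apply: filterS (open_nbhs_nbhs (conj oA Ax)) => y /fg.
case: n => [|n] /=.
  move=> cf x Ax; change (g @ x --> g x); rewrite -(fg _ Ax).
  by apply: cvg_trans (cf _ Ax); apply: near_eq_cvg; exact: near_fg.
case=> f' ff' Cf'; exists f' => // x Ax.
exact: is_diff_near (near_fg _ Ax) (ff' _ Ax).
Qed.

(** On an open set the derivative is unique, so the existential witness in Cn may
    be taken to be dclin f. As dclin f x depends only on the germ of f at x, this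
    makes Cn a local property (Cn_local). *)
Lemma CnS n E F (A : set E) (f : E -> F) : open A ->
  Cn n.+1 A f <-> (forall x, A x -> differentiable f x) /\ Cn n A (dclin f).
Proof.
move=> oA; split=> [[f' ff' Cf']|[df Cf']].
  split=> [x /ff'[]//|]; apply: Cn_eq oA _ Cf' => x Ax.
  by rewrite (dclin_val (ff' _ Ax)).
by exists (dclin f) => // x Ax; apply: dclinP; exact: df.
Qed.

Lemma Cn_local n E F (A : set E) (f : E -> F) : open A ->
  (forall x, A x -> exists B, [/\ open B, B x & Cn n B f]) -> Cn n A f.
Proof.
move=> oA; elim: n F f => [|n IHn] F f loc.
  by move=> x /loc[B [_ Bx]]; exact.
apply/CnS => //; split=> [x /loc[B [oB Bx /CnS[]]]//|]; first by move=> + _; apply.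
by apply: IHn => x /loc[B [oB Bx /CnS[]]]// _ ?; exists B.
Qed.

Lemma CnD n E F (A : set E) (f g : E -> F) :
  Cn n A f -> Cn n A g -> Cn n A (fun x => f x + g x).
Proof.
elim: n F f g => [|n IHn] F f g.
  by move=> cf cg x Ax; apply: cvgD; [exact: cf|exact: cg].
case=> f' ff' Cf' [g' gg' Cg']; exists (fun x => f' x + g' x); last exact: IHn.
by move=> x Ax; apply: is_diff_clinD; [exact: ff'|exact: gg'].
Qed.

(** The two terms of the derivative are bounded bilinear expressions in (f', g)
    and in (f, g'), to which the induction hypothesis applies because B is
    quantified inside the induction. *)
Lemma Cn_bilinear n E F G H (B : F -> G -> H) (A : set E) f g :
  bounded_bilinear B -> Cn n A f -> Cn n A g -> Cn n A (fun x => B (f x) (g x)).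
Proof.
elim: n F G H B f g => [|n IHn] F G H B f g hB.
  move=> cf cg x Ax.
  have cB : {for (f x, g x), continuous (fun q => B q.1 q.2)}.
    by apply: differentiable_continuous; case: (is_diff_bilinear_pair hB (f x, g x)).
  apply: (@continuous_comp _ _ _ (fun x => (f x, g x)) (fun q => B q.1 q.2)) => //.
  by apply: cvg_pair; [exact: cf|exact: cg].
move=> Cf Cg; move: (Cf) (Cg) => [f' ff' Cf'] [g' gg' Cg'].
exists (fun x => clin_compl B (f' x) (g x) + clin_compr B (f x) (g' x)).
  by move=> x Ax; apply: is_diff_bilinear => //; [exact: ff'|exact: gg'].
apply: CnD; apply: IHn; rewrite //; try exact: CnW.
- exact: bounded_bilinear_compl.
- exact: bounded_bilinear_compr.
Qed.

(** The derivative x |-> g'(f x) o f'(x) is a bounded bilinear expression in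
    g' o f, covered by the induction hypothesis, and in f'. *)
Lemma Cn_comp n E F G (A : set E) (B : set F) (f : E -> F) (g : F -> G) :
  (forall x, A x -> B (f x)) -> Cn n A f -> Cn n B g -> Cn n A (g \o f).
Proof.
move=> AB; elim: n G g => [|n IHn] G g.
  by move=> cf cg x Ax; apply: continuous_comp; [exact: cf|exact/cg/AB].
move=> Cf [g' gg' Cg']; move: (Cf) => [f' ff' Cf'].
exists (fun x => clin_comp (g' (f x)) (f' x)).
  by move=> x Ax; apply: is_diff_clin_comp; [exact: ff'|exact/gg'/AB].
apply: Cn_bilinear => //; first exact: bounded_bilinear_comp.
by apply: IHn => //; exact: CnW.
Qed.

Lemma smooth_on_clin E F (A : set E) (u : clin E F) : smooth_on A u.
Proof.
move=> [|n]; first by move=> x _; exact: clin_continuous.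
by exists (fun=> u) => [x _|]; [exact: clin_is_diff|exact: smooth_on_cst].
Qed.

Lemma smooth_on_subset E F (A B : set E) (f : E -> F) :
  A `<=` B -> smooth_on B f -> smooth_on A f.
Proof. by move=> AB sf n; exact: Cn_subset (sf n). Qed.

(** Smoothness of a germ. Unlike smooth_on it composes without any bookkeeping of
    domains; smooth_onP translates between the two. *)
Definition smooth_at E F (x : E) (f : E -> F) : Prop :=
  exists A, [/\ open A, A x & smooth_on A f].

Lemma smooth_onP E F (A : set E) (f : E -> F) : open A ->
  smooth_on A f <-> forall x, A x -> smooth_at x f.
Proof.
move=> oA; split=> [sf x Ax|sf n]; first by exists A.
by apply: Cn_local => // x /sf[B [oB Bx fB]]; exists B.
Qed.

Lemma smooth_at_on E F (A : set E) (f : E -> F) x :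
  open A -> A x -> smooth_on A f -> smooth_at x f.
Proof. by exists A. Qed.

Lemma smooth_at_near E F x (f : E -> F) :
  smooth_at x f -> \forall y \near x, smooth_at y f.
Proof.
case=> A [oA Ax sA]; apply: filterS (open_nbhs_nbhs (conj oA Ax)) => y Ay.
by exists A.
Qed.

Lemma smooth_at_eq E F x (f g : E -> F) :
  (\forall y \near x, f y = g y) -> smooth_at x f -> smooth_at x g.
Proof.
move=> fg [A [oA Ax sA]].
pose B := interior [set y | f y = g y].
have oAB : open (A `&` B) by apply: openI => //; exact: open_interior.
exists (A `&` B); split=> // n; apply: Cn_eq (Cn_subset (@subIsetl _ A B) (sA n)) => //.
by move=> y [_ /interior_subset].
Qed.

Lemma smooth_at_differentiable E F x (f : E -> F) : smooth_at x f -> differentiable f x.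
Proof. by case=> A [oA Ax /(_ 1) [f' + _]] => /(_ _ Ax)[]. Qed.

Lemma smooth_at_continuous E F x (f : E -> F) : smooth_at x f -> {for x, continuous f}.
Proof. by move=> /smooth_at_differentiable; exact: differentiable_continuous. Qed.

Lemma smooth_at_dclin E F x (f : E -> F) : smooth_at x f -> smooth_at x (dclin f).
Proof.
case=> A [oA Ax sA]; exists A; split=> // n.
by have /CnS[]// := sA n.+1.
Qed.

Lemma smooth_at_cst E F x (c : F) : smooth_at x (fun _ : E => c).
Proof. exists setT; split=> //; [exact: openT|exact: smooth_on_cst]. Qed.

Lemma smooth_at_clin E F x (u : clin E F) : smooth_at x u.
Proof. exists setT; split=> //; [exact: openT|exact: smooth_on_clin]. Qed.

Lemma smooth_at_setI E F G x (f : E -> F) (g : E -> G) :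
  smooth_at x f -> smooth_at x g ->
  exists A, [/\ open A, A x, smooth_on A f & smooth_on A g].
Proof.
case=> [A [oA Ax sA]] [B [oB Bx sB]]; exists (A `&` B); split=> //.
- exact: openI.
- exact: smooth_on_subset sA.
- exact: smooth_on_subset sB.
Qed.

Lemma smooth_atD E F x (f g : E -> F) :
  smooth_at x f -> smooth_at x g -> smooth_at x (fun y => f y + g y).
Proof.
move=> /smooth_at_setI h/h[A [oA Ax sf sg]]; exists A; split=> // n; exact: CnD.
Qed.

Lemma smooth_at_bilinear E F G H (B : F -> G -> H) x (f : E -> F) (g : E -> G) :
  bounded_bilinear B -> smooth_at x f -> smooth_at x g ->
  smooth_at x (fun y => B (f y) (g y)).
Proof.
move=> hB /smooth_at_setI h/h[A [oA Ax sf sg]]; exists A; split=> // n.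
exact: Cn_bilinear.
Qed.

Lemma smooth_at_comp E F G x (f : E -> F) (g : F -> G) :
  smooth_at x f -> smooth_at (f x) g -> smooth_at x (fun y => g (f y)).
Proof.
case=> [A [oA Ax sA]] [B [oB Bx sB]].
exists (A `&` f @^-1` B); split=> //; last first.
  move=> n; apply: (@Cn_comp _ _ _ _ _ B f g) (sB n); first by move=> y [].
  by apply: Cn_subset (sA n); exact: subIsetl.
rewrite openE => y [Ay By]; apply: filterI; first exact: open_nbhs_nbhs.
apply: (Cn_continuous (sA 0) Ay); exact: open_nbhs_nbhs.
Qed.

Lemma smooth_at_clin_comp E F G x (f : E -> F) (u : clin F G) :
  smooth_at x f -> smooth_at x (fun y => u (f y)).
Proof. by move=> sf; apply: smooth_at_comp => //; exact: smooth_at_clin. Qed.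

Lemma smooth_at_id E (x : E) : smooth_at x (fun y => y).
Proof. by have := smooth_at_clin x (clin_id E); rewrite clin_idE. Qed.

Lemma smooth_at_fst E F G x (f : E -> F * G) :
  smooth_at x f -> smooth_at x (fun y => (f y).1).
Proof. by move=> /(smooth_at_clin_comp (clin_fst F G)); rewrite clin_fstE. Qed.

Lemma smooth_at_snd E F G x (f : E -> F * G) :
  smooth_at x f -> smooth_at x (fun y => (f y).2).
Proof. by move=> /(smooth_at_clin_comp (clin_snd F G)); rewrite clin_sndE. Qed.

(** A pair is the sum of its images under the two injections. *)
Lemma smooth_at_pair E F G x (f : E -> F) (g : E -> G) :
  smooth_at x f -> smooth_at x g -> smooth_at x (fun y => (f y, g y)).
Proof.
move=> /(smooth_at_clin_comp (clin_inl F G)) + /(smooth_at_clin_comp (clin_inr F G)).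
move=> sf sg; have := smooth_atD sf sg; rewrite clin_inlE clin_inrE.
by congr smooth_at; apply/funext => y; congr (_, _); rewrite /= ?addr0 ?add0r.
Qed.

Lemma smooth_at_eval E F G x (u : E -> clin F G) (f : E -> F) :
  smooth_at x u -> smooth_at x f -> smooth_at x (fun y => u y (f y)).
Proof. exact: smooth_at_bilinear (@bounded_bilinear_eval _ F G). Qed.

Lemma smooth_at_compM E F G H x (u : E -> clin G H) (v : E -> clin F G) :
  smooth_at x u -> smooth_at x v -> smooth_at x (fun y => clin_comp (u y) (v y)).
Proof. exact: smooth_at_bilinear (@bounded_bilinear_comp _ F G H). Qed.

Lemma smooth_at_fst_id E F (p : E * F) : smooth_at p (fun q => q.1).
Proof. exact: smooth_at_fst (smooth_at_id p). Qed.

Lemma smooth_at_snd_id E F (p : E * F) : smooth_at p (fun q => q.2).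
Proof. exact: smooth_at_snd (smooth_at_id p). Qed.

Lemma open_fst_preimage E F (U : set E) : open U -> open [set p : E * F | U p.1].
Proof.
move=> oU; rewrite openE => p pU.
exact: (smooth_at_continuous (smooth_at_fst (smooth_at_id p)) (open_nbhs_nbhs (conj oU pU))).
Qed.

Lemma dclin_clin E F (u : clin E F) x : dclin u x = u.
Proof. exact: dclin_val (clin_is_diff u x). Qed.

Lemma dclin_comp E F G x (f : E -> F) (g : F -> G) :
  differentiable f x -> differentiable g (f x) ->
  forall h, dclin (fun y => g (f y)) x h = dclin g (f x) (dclin f x h).
Proof.
move=> df dg h; rewrite -clin_compE.
by rewrite (dclin_val (is_diff_clin_comp (dclinP df) (dclinP dg))).
Qed.

Lemma dclin_eval E F G x (u : E -> clin F G) (f : E -> F) :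
  differentiable u x -> differentiable f x ->
  forall h, dclin (fun y => u y (f y)) x h = dclin u x h (f x) + u x (dclin f x h).
Proof.
move=> du df h; have hB := @bounded_bilinear_eval _ F G.
rewrite (dclin_val (is_diff_bilinear hB (dclinP du) (dclinP df))).
by rewrite clin_addE clin_complE// clin_comprE.
Qed.

Lemma dclin_pair E F G x (f : E -> F) (g : E -> G) :
  differentiable f x -> differentiable g x ->
  forall h, dclin (fun y => (f y, g y)) x h = (dclin f x h, dclin g x h).
Proof.
move=> df dg h; rewrite dclin_diff; last exact: differentiable_pair.
by rewrite diff_pair// !dclin_diff.
Qed.

Lemma dclin_eq E F x (f g : E -> F) :
  (\forall y \near x, f y = g y) -> differentiable f x -> dclin f x = dclin g x.
Proof. by move=> fg df; rewrite (dclin_val (is_diff_near fg (dclinP df))). Qed.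

Lemma dclin_post E F G x (u : clin F G) (f : E -> F) : differentiable f x ->
  forall h, dclin (fun y => u (f y)) x h = u (dclin f x h).
Proof.
move=> df h; rewrite dclin_comp ?dclin_clin//.
by case: (clin_is_diff u (f x)).
Qed.

Lemma dclinD E F x (f g : E -> F) : differentiable f x -> differentiable g x ->
  forall h, dclin (fun y => f y + g y) x h = dclin f x h + dclin g x h.
Proof.
move=> df dg h.
by rewrite (dclin_val (is_diff_clinD (dclinP df) (dclinP dg))).
Qed.

Lemma dclin_bilinear E F G H (B : F -> G -> H) x (f : E -> F) (g : E -> G) :
  bounded_bilinear B -> differentiable f x -> differentiable g x ->
  forall h, dclin (fun y => B (f y) (g y)) x h = B (dclin f x h) (g x) + B (f x) (dclin g x h).
Proof.
move=> hB df dg h; rewrite (dclin_val (is_diff_bilinear hB (dclinP df) (dclinP dg))).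
by rewrite clin_addE clin_complE// clin_comprE.
Qed.

Lemma dclin_fst E F (p h : E * F) : dclin (fun q : E * F => q.1) p h = h.1.
Proof. by have := dclin_clin (clin_fst E F) p; rewrite clin_fstE => ->; rewrite clin_fstE. Qed.

Lemma dclin_snd E F (p h : E * F) : dclin (fun q : E * F => q.2) p h = h.2.
Proof. by have := dclin_clin (clin_snd E F) p; rewrite clin_sndE => ->; rewrite clin_sndE. Qed.

Lemma dclin_cst E F (c : F) x h : dclin (fun _ : E => c) x h = 0.
Proof. by rewrite (@dclin_val _ _ _ _ _ 0)//; exact: is_diff_cst. Qed.

Lemma dclin_left_inverse E F (f : E -> F) (g : F -> E) x :
  differentiable f x -> differentiable g (f x) -> (forall y, g (f y) = y) ->
  forall h, dclin g (f x) (dclin f x h) = h.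
Proof.
move=> df dg gf h; rewrite -dclin_comp// (_ : (fun y => _) = clin_id E).
  by rewrite dclin_clin clin_idE.
by apply/funext => y; rewrite gf clin_idE.
Qed.

(** The second derivative in the directions u, v is the derivative along u of the
    first derivative along v, in which v is frozen. *)
Lemma dclin2E E F x (f : E -> F) : smooth_at x f ->
  forall u v, dclin (dclin f) x u v = dclin (fun z => dclin f z v) x u.
Proof.
move=> sf u v; have sdf := smooth_at_differentiable (smooth_at_dclin sf).
have sv := smooth_at_differentiable (smooth_at_cst x v).
by rewrite (dclin_eval sdf sv) dclin_cst linear0 addr0.
Qed.

(** The first order chain rule holds in a neighbourhood of x, so it can be
    differentiated, with the product rule for evaluation. *)
Lemma dclin2_comp E F G x (f : E -> F) (g : F -> G) :
  smooth_at x f -> smooth_at (f x) g -> forall u v,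
  dclin (dclin (fun y => g (f y))) x u v =
  dclin (dclin g) (f x) (dclin f x u) (dclin f x v) +
  dclin g (f x) (dclin (dclin f) x u v).
Proof.
move=> sf sg u v; rewrite dclin2E; last exact: smooth_at_comp.
have sdg := smooth_at_comp sf (smooth_at_dclin sg).
have sdf := smooth_at_eval (smooth_at_dclin sf) (smooth_at_cst x v).
have near_chain : \forall y \near x,
    dclin g (f y) (dclin f y v) = dclin (fun y => g (f y)) y v.
  have cf := smooth_at_continuous sf.
  have near_g : \forall y \near x, smooth_at (f y) g by exact: cf (smooth_at_near sg).
  apply: filterS2 (smooth_at_near sf) near_g => y.
  move=> /smooth_at_differentiable dfy /smooth_at_differentiable dgy.
  exact: esym (dclin_comp dfy dgy v).
rewrite -(dclin_eq near_chain); last first.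
  by apply: smooth_at_differentiable; exact: smooth_at_eval.
rewrite (dclin_eval (smooth_at_differentiable sdg) (smooth_at_differentiable sdf)).
rewrite -(dclin2E sf u v).
rewrite (dclin_comp (smooth_at_differentiable sf)) //.
exact: smooth_at_differentiable (smooth_at_dclin sg).
Qed.

Lemma dclin2_clin E F (T : clin E F) x u v : dclin (dclin T) x u v = 0.
Proof.
have -> : dclin T = fun=> T by apply/funext => y; rewrite dclin_clin.
by rewrite dclin_cst.
Qed.

Lemma dclin2_post E F G x (u : clin F G) (f : E -> F) : smooth_at x f ->
  forall h k, dclin (dclin (fun y => u (f y))) x h k = u (dclin (dclin f) x h k).
Proof.
move=> sf h k; rewrite (dclin2_comp sf (smooth_at_clin _ u)).
by rewrite dclin2_clin add0r dclin_clin.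
Qed.

Lemma fiber_smooth F G H (f : F * G -> H) y e :
  smooth_at (y, e) f -> smooth_at e (fun e => f (y, e)).
Proof.
move=> sf; apply: smooth_at_comp sf.
by apply: smooth_at_pair; [exact: smooth_at_cst|exact: smooth_at_id].
Qed.

Lemma dclin_fiber_incl F G (y : F) (e : G) k :
  dclin (fun e => (y, e)) e k = (0, k).
Proof.
apply: etrans (dclin_pair (smooth_at_differentiable (smooth_at_cst e y))
  (smooth_at_differentiable (smooth_at_id e)) k) _.
rewrite dclin_cst; congr (_, _).
by have := dclin_clin (clin_id G) e; rewrite clin_idE => ->; rewrite clin_idE.
Qed.

(** Partial derivatives in the second variable: the inclusion e |-> (y, e) of a
    fibre is affine with linear part k |-> (0, k). *)
Lemma dclin_fiber F G H (f : F * G -> H) y e : smooth_at (y, e) f ->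
  forall k, dclin (fun e => f (y, e)) e k = dclin f (y, e) (0, k).
Proof.
move=> sf k; have sp := smooth_at_pair (smooth_at_cst e y) (smooth_at_id e).
apply: etrans (dclin_comp (smooth_at_differentiable sp) (smooth_at_differentiable sf) k) _.
by rewrite dclin_fiber_incl.
Qed.

Lemma dclin2_fiber F G H (f : F * G -> H) y e : smooth_at (y, e) f ->
  forall k l, dclin (dclin (fun e => f (y, e))) e k l = dclin (dclin f) (y, e) (0, k) (0, l).
Proof.
move=> sf k l; have sp := smooth_at_pair (smooth_at_cst e y) (smooth_at_id e).
apply: etrans (dclin2_comp sp sf k l) _.
rewrite !dclin_fiber_incl (dclin2E sp).
have -> : (fun z => dclin (fun e => (y, e)) z l) = (fun=> (0, l)).
  by apply/funext => z; rewrite dclin_fiber_incl.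
by rewrite dclin_cst linear0 addr0.
Qed.

(** When a quantity Q on a set D is locally a smooth function of the parameters P,
    it depends on P alone, and the function so obtained on P @` D agrees near each
    point with one of the given smooth ones. *)
Lemma smooth_glue E G (X : Type) (D : set X) (P : X -> E) (Q : X -> G) :
  open (P @` D) ->
  (forall x, D x -> exists2 s : E -> G, smooth_at (P x) s &
     \forall p \near P x, forall x', D x' -> P x' = p -> Q x' = s p) ->
  exists F : E -> G, forall x, D x -> smooth_at (P x) F /\ Q x = F (P x).
Proof.
move=> oPD loc.
pose F p := if pselect (exists2 x, D x & P x = p) is left h then Q (s2val (cid2 h)) else 0.
exists F => x Dx; have [s ss near_s] := loc x Dx.
have Fs p : (P @` D) p -> (forall x', D x' -> P x' = p -> Q x' = s p) -> F p = s p.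
  rewrite /F => -[z Dz zp] H; case: pselect => [h|[]]; last by exists z.
  by case: cid2 => t /= Dt tp; exact: H.
split; last by rewrite Fs; [exact: (nbhs_singleton near_s)|exists x|exact: (nbhs_singleton near_s)].
apply: smooth_at_eq ss.
have near_P : \forall p \near P x, (P @` D) p by apply: open_nbhs_nbhs; split=> //; exists x.
by apply: filterS2 near_P near_s => p pD H; rewrite Fs.
Qed.

End smooth_calculus.

(** * Mean value inequality and symmetry of second derivatives *)

Section schwarz.
Context {R : realType}.
Implicit Types E F G H : normedModType R.

Lemma derive1_dclin F (f : R -> F) t : differentiable f t ->
  derive1 f t = dclin f t 1.
Proof. by move=> df; rewrite derive1E deriveE// dclin_diff. Qed.

Lemma near_lipschitz F (f : R -> F) (K e : R) t : 0 < e ->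
  differentiable f t -> `|derive1 f t| <= K ->
  exists2 d : R, 0 < d &
    forall s, `|s - t| < d -> `|f s - f t| <= (K + e) * `|s - t|.
Proof.
move=> e0 df fK; have /is_diff_normP/(_ e e0)/nbhs_normP[d d0 H] := dclinP df.
exists d => // s std; have := H (s - t); rewrite /= sub0r normrN subrK => /(_ std).
have -> : dclin f t (s - t) = (s - t) *: derive1 f t.
  by rewrite derive1_dclin// -linearZ /= [_ *: _]mulr1.
move=> st; have := ler_normD (f s - (f t + (s - t) *: derive1 f t)) ((s - t) *: derive1 f t).
rewrite [X in `|X| <= _](_ : _ = f s - f t); last by rewrite opprD addrA subrK.
move=> /le_trans; apply; rewrite addrC mulrDl lerD// normrZ mulrC ler_wpM2r//.
Qed.

(** For every e > 0, let c be the supremum of the t for which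
    |f s - f 0| <= (K + e) s holds up to t. The local estimate near_lipschitz at c
    extends this bound to c and, if c < 1, beyond c. *)
Lemma mean_value_inequality F (f : R -> F) (K : R) :
  (forall t : R, 0 <= t <= 1 -> differentiable f t) ->
  (forall t : R, 0 <= t <= 1 -> `|derive1 f t| <= K) ->
  `|f 1 - f 0| <= K.
Proof.
move=> df fK; apply/ler_addgt0Pr => e e0.
have Ke : 0 <= K + e.
  by rewrite addr_ge0 ?(ltW e0)// (le_trans _ (fK 0 _))// lexx ler01.
pose S := [set t : R | 0 <= t <= 1 /\
  forall s, 0 <= s <= t -> `|f s - f 0| <= (K + e) * s].
have S0 : S 0.
  split; first by rewrite lexx ler01.
  by move=> s /le_anti <-; rewrite subrr normr0 mulr0.
have S_ne : S !=set0 by exists 0.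
have hS : has_sup S by split=> //; exists 1 => t [/andP[]].
set c := sup S.
have c01 : 0 <= c <= 1.
  rewrite (sup_upper_bound hS)//=; apply: ge_sup; first by exists 0.
  by move=> t [/andP[]].
have [d d0 Hd] := near_lipschitz e0 (df c c01) (fK c c01).
have below s : 0 <= s -> s < c -> `|f s - f 0| <= (K + e) * s.
  move=> s0 /(sup_gt S_ne)[t [t01 tS] st]; apply: tS.
  by rewrite s0 ltW.
have atc : `|f c - f 0| <= (K + e) * c.
  have [->|c0] := eqVneq c 0; first by rewrite subrr normr0 mulr0.
  have {}c0 : 0 < c by rewrite lt_def c0; case/andP: c01.
  pose s := Num.max 0 (c - d / 2).
  have s0 : 0 <= s by rewrite le_max lexx.
  have sc : s < c by rewrite gt_max c0/= gtrBl divr_gt0.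
  have scd : `|s - c| < d.
    rewrite distrC gtr0_norm ?subr_gt0// ltrBlDr -ltrBlDl.
    apply: (@lt_le_trans _ _ (c - d / 2)); last by rewrite le_max lexx orbT.
    by rewrite ltrD2l ltrN2 gtr_pMr// invf_lt1// ltr1n.
  rewrite -[f c - f 0](subrKA (f s)); apply: le_trans (ler_normD _ _) _.
  have := Hd s scd; rewrite distrC [`|s - c|]distrC gtr0_norm ?subr_gt0// => h.
  by apply: le_trans (lerD h (below s s0 sc)) _; rewrite -mulrDr subrK.
have : c = 1.
  apply/eqP; rewrite eq_le; move: (c01) => /andP[c0 ->] /=; rewrite leNgt; apply/negP => c1.
  pose t := Num.min 1 (c + d / 2).
  have ct : c < t by rewrite lt_min c1/= ltrDl divr_gt0.
  have tS : S t.
    have t1 : t <= 1 by rewrite ge_min lexx.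
    split; first by rewrite t1 (le_trans c0 (ltW ct)).
    move=> s /andP[s0 st]; have [sc|cs] := ltP s c; first exact: below.
    rewrite -[f s - f 0](subrKA (f c)); apply: le_trans (ler_normD _ _) _.
    have scd : `|s - c| < d.
      rewrite ger0_norm ?subr_ge0// ltrBlDl; apply: le_lt_trans st _.
      rewrite gt_min; apply/orP; right.
      by rewrite ltrD2l gtr_pMr// invf_lt1// ltr1n.
    have := Hd s scd; rewrite [`|s - c|]ger0_norm ?subr_ge0// => h.
    by apply: le_trans (lerD h atc) _; rewrite -mulrDr subrK.
  by have := sup_upper_bound hS tS; rewrite leNgt ct.
by move=> c1; move: atc; rewrite c1 mulr1.
Qed.

Lemma subr_shifted (V : zmodType) (a b w z : V) :
  a - (w + z) - (b - w) = a - b - z.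
Proof. by rewrite opprB opprD [w - b]addrC addrACA [- w - z + w]addrAC addNr add0r. Qed.

(** The second difference of f minus f''(k)(h) is the increment between 0 and 1 of
    g t = f (t h + k + x) - f (t h + x) - t f''(k)(h). The derivative of g is a
    difference of two first order remainders of f', applied to h. *)
Lemma schwarz_estimate E F (f : E -> F) (x : E) (e d : R) (h k : E) :
  (forall l : E, `|l| < d -> differentiable f (l + x)) ->
  (forall l : E, `|l| < d ->
    `|dclin f (l + x) - (dclin f x + dclin (dclin f) x l)| <= e * `|l|) ->
  0 <= e -> `|h| + `|k| < d ->
  `|f (h + k + x) - f (h + x) - (f (k + x) - f x) - dclin (dclin f) x k h|
     <= 2 * e * (`|h| + `|k|) * `|h|.
Proof.
move=> df ddf e0 hkd; set A := dclin (dclin f) x.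
pose g (t : R) := f (t *: h + (k + x)) - f (t *: h + x) - t *: A k h.
have -> : f (h + k + x) - f (h + x) - (f (k + x) - f x) - A k h = g 1 - g 0.
  rewrite /g !scale1r !scale0r subr0 !add0r [h + (k + x)]addrA.
  by rewrite [LHS]addrAC.
have th (t : R) : 0 <= t <= 1 -> `|t *: h| <= `|h|.
  by move=> /andP[t0 t1]; rewrite normrZ ger0_norm// ler_piMl.
have bd (t : R) : 0 <= t <= 1 -> `|t *: h| < d /\ `|t *: h + k| < d.
  move=> /th{}th; split; apply: le_lt_trans hkd; first by rewrite (le_trans th)// lerDl.
  by rewrite (le_trans (ler_normD _ _))// lerD2r.
pose ray l (t : R) := clin_line h t + l.
have dray l t : is_diff t (ray l) (clin_line h).
  have := is_diff_clinD (clin_is_diff (clin_line h) t) (is_diff_cst l t : is_diff t _ (0 : clin _ _)).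
  by rewrite addr0.
pose u (t : R) : clin R F :=
  clin_comp (dclin f (ray (k + x) t)) (clin_line h) -
  clin_comp (dclin f (ray x t)) (clin_line h) - clin_line (A k h).
have rayE l t : ray l t = t *: h + l by rewrite /ray clin_lineE.
have gE : g = (fun t => (f \o ray (k + x)) t - (f \o ray x) t - clin_line (A k h) t).
  by apply/funext => t; rewrite /= !rayE clin_lineE.
have dg (t : R) : 0 <= t <= 1 -> is_diff t g (u t).
  move=> /bd[h1 h2]; rewrite gE.
  have d1 : differentiable f (ray x t) by rewrite rayE; exact: df.
  have d2 : differentiable f (ray (k + x) t) by rewrite rayE addrA; exact: df.
  apply: is_diffB; last exact: clin_is_diff.
  by apply: is_diffB; apply: is_diff_clin_comp => //; exact: dclinP.
apply: mean_value_inequality => t t01.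
  by case: (dg t t01).
have [h1 h2] := bd t t01.
rewrite derive1_dclin; last by case: (dg t t01).
rewrite (dclin_val (dg t t01)) /u !clin_addE !clin_oppE !clin_compE !clin_lineE !scale1r !rayE.
rewrite addrA -!clin_oppE -!clin_addE.
have -> : dclin f (t *: h + k + x) - dclin f (t *: h + x) - A k =
   (dclin f (t *: h + k + x) - (dclin f x + A (t *: h + k))) -
   (dclin f (t *: h + x) - (dclin f x + A (t *: h))).
  by rewrite [A (_ + _)]linearD [dclin f x + (_ + _)]addrA subr_shifted.
apply: le_trans (clin_norm_le _ _) _; rewrite ler_wpM2r//.
apply: le_trans (ler_normB _ _) _.
rewrite -mulrA mulr_natl mulr2n.
apply: lerD; apply: le_trans (ddf _ _) _ => //; rewrite ler_wpM2l//.
  by apply: le_trans (ler_normD _ _) _; rewrite lerD2r; exact: th.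
by apply: le_trans (th _ t01) _; rewrite lerDl.
Qed.

(** The second difference of f in the directions h and k is symmetric, and it
    approximates both f''(k)(h) and f''(h)(k) up to e (|h| + |k|)^2. With h = s u
    and k = s v, dividing by s^2 leaves a bound of order e. *)
Lemma second_derivative_symmetric E F (f : E -> F) x :
  (\forall y \near x, differentiable f y) -> differentiable (dclin f) x ->
  forall u v, dclin (dclin f) x u v = dclin (dclin f) x v u.
Proof.
move=> /nbhs0P near_df ddf u v; set A := dclin (dclin f) x.
pose m := (`|u| + `|v|) * (`|u| + `|v|).
suff small (e : R) : 0 < e -> `|A u v - A v u| <= e * (2 * m).
  have m0 : 0 <= 2 * m by rewrite !mulr_ge0// addr_ge0.
  have m1 : 0 < 2 * m + 1 by rewrite ltr_wpDl.
  apply/eqP; rewrite -subr_eq0 -normr_le0; apply/ler_addgt0Pr => e e0.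
  rewrite add0r; apply: le_trans (small (e / (2 * m + 1)) _) _.
    by rewrite divr_gt0.
  by rewrite mulrAC ler_pdivrMr// ler_pM2l// lerDl.
move=> e0.
have /is_diff_normP/(_ e e0) near_A := dclinP ddf.
have /nbhs_normP[d d0 H] : \forall l \near (0 : E), differentiable f (x + l) /\
    `|dclin f (l + x) - (dclin f x + A l)| <= e * `|l|.
  exact: filterI near_df near_A.
have {near_df near_A}dfH (l : E) : `|l| < d -> differentiable f (l + x).
  by move=> ld; have [] := H l; rewrite /= ?sub0r ?normrN// addrC.
have ddfH (l : E) : `|l| < d ->
    `|dclin f (l + x) - (dclin f x + A l)| <= e * `|l|.
  by move=> ld; have [] := H l; rewrite /= ?sub0r ?normrN.
(* The scale s keeps |s u| + |s v| < d, also when u = v = 0. *)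
pose s := d / (2 * (`|u| + `|v| + 1)).
have n0 : 0 <= `|u| + `|v| by rewrite addr_ge0.
have s0 : 0 < s by rewrite divr_gt0// mulr_gt0// ltr_wpDl.
have sd : s * (`|u| + `|v|) < d.
  rewrite /s mulrAC ltr_pdivrMr ?mulr_gt0 ?ltr_wpDl// ltr_pM2l//.
  rewrite (@lt_le_trans _ _ (`|u| + `|v| + 1)) ?ltrDl//.
  by rewrite ler_peMl ?addr_ge0// ler1n.
have sn w : `|s *: w| = s * `|w| by rewrite normrZ gtr0_norm.
have e0' := ltW e0.
have e1 := @schwarz_estimate _ _ f x e d (s *: u) (s *: v) dfH ddfH e0'.
have e2 := @schwarz_estimate _ _ f x e d (s *: v) (s *: u) dfH ddfH e0'.
rewrite !sn -!mulrDr in e1 e2.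
have {}e1 := e1 sd; rewrite [`|v| + `|u|]addrC in e2; have {}e2 := e2 sd.
have := lerD e2 e1 => {e1 e2}; rewrite -mulrDr -mulrDr [`|v| + `|u|]addrC => e12.
rewrite -(ler_pM2l (mulr_gt0 s0 s0)).
have -> : s * s * (e * (2 * m)) = 2 * e * (s * (`|u| + `|v|)) * (s * (`|u| + `|v|)).
  rewrite /m; ring.
apply: le_trans e12; apply: le_trans (ler_normB _ _).
rewrite le_eqVlt; apply/orP; left; apply/eqP.
rewrite [`|A u v - _|]distrC -[s * s](@gtr0_norm _ _ (mulr_gt0 s0 s0)) -normrZ; congr (`|_|).
have AE w z : A (s *: w) (s *: z) = (s * s) *: A w z.
  by rewrite (clinZ (A _)) (clinZ A) clin_scaleE scalerA.
rewrite -/A !AE scalerBr [s *: v + _]addrC.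
have swap (a b c : F) : a - b - (c - f x) = a - c - (b - f x).
  by rewrite !opprB addrACA [RHS]addrACA; congr (_ + _); rewrite addrC.
have cancel_common (a b c : F) : a - b - (a - c) = c - b.
  by rewrite opprB addrC addrA subrK.
by rewrite [f _ - f (s *: u + x) - _]swap cancel_common.
Qed.

End schwarz.

(** * Christoffel symbols of a pair of inverse diffeomorphisms *)

Section christoffel.
Context {R : realType}.
Variable E : normedModType R.

(** The second derivative of H at the zero vector, brought back to the source by
    DK (H 0), the inverse of DH 0. The factor 1/2 is that of the
    second order term in Taylor's formula for H. *)
Definition christoffel (H K : E * E -> E * E) (u v : E) : E :=
  (dclin K (H 0) (2^-1 *: dclin (dclin H) 0 (u, 0) (v, 0))).2.

(** Differentiating Hb o th = T2 o Ha twice at 0 gives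
    D^2 Hb (T2 u, T2 v) + DHb (D^2 th (u, v)) = T2 (D^2 Ha (u, v)), and
    differentiating once gives DHb o T2 = T2 o DHa, hence DKb o T2 = T2 o DKa.
    Applying DKb to the first identity proves the claim. *)
Lemma second_derivative_conjugate (Ha Ka Hb Kb th : E * E -> E * E)
    (T2 : clin (E * E)%type (E * E)%type) :
  (forall e, smooth_at e Ha) -> (forall e, smooth_at e Ka) ->
  (forall e, smooth_at e Hb) -> (forall e, smooth_at e Kb) ->
  (forall e, Ka (Ha e) = e) -> (forall e, Ha (Ka e) = e) -> (forall e, Kb (Hb e) = e) ->
  (forall e, smooth_at e th) -> th 0 = 0 -> (forall h, dclin th 0 h = T2 h) ->
  (fun z => Hb (th z)) = (fun z => T2 (Ha z)) ->
  forall u v, 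
  dclin Kb (Hb 0) (dclin (dclin Hb) 0 (T2 u) (T2 v)) + dclin (dclin th) 0 u v =
  T2 (dclin Ka (Ha 0) (dclin (dclin Ha) 0 u v)).
Proof.
move=> sHa sKa sHb sKb KHa HKa KHb sth th0 dth equiv u v.
have dif (F G : normedModType R) (z : F) (f : F -> G) := @smooth_at_differentiable _ _ _ z f.
have eq1 h : dclin Hb 0 (T2 h) = T2 (dclin Ha 0 h).
  have := congr1 (fun f => dclin f 0 h) equiv.
  rewrite (dclin_comp (dif _ _ _ _ (sth 0)) (dif _ _ _ _ (sHb _))) dth th0 => ->.
  by rewrite (dclin_post T2 (dif _ _ _ _ (sHa 0))).
have eq2 : dclin (dclin Hb) 0 (T2 u) (T2 v) + dclin Hb 0 (dclin (dclin th) 0 u v)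
    = T2 (dclin (dclin Ha) 0 u v).
  have := congr1 (fun f => dclin (dclin f) 0 u v) equiv.
  by rewrite (dclin2_comp (sth 0) (sHb _)) (dclin2_post T2 (sHa 0)) th0 !dth.
set X := dclin (dclin Ha) 0 u v in eq2 *.
set Y := dclin Ka (Ha 0) X.
(* DKa (Ha 0) is also a right inverse of DHa 0, because Ha o Ka is the identity. *)
have XY : X = dclin Ha 0 Y.
  have := dclin_left_inverse (dif _ _ _ _ (sKa (Ha 0))) (dif _ _ _ _ (sHa (Ka (Ha 0)))) HKa X.
  by rewrite KHa.
have KH h : dclin Kb (Hb 0) (dclin Hb 0 h) = h.
  by rewrite dclin_left_inverse//; exact: dif.
have := congr1 (dclin Kb (Hb 0)) eq2; rewrite clinD KH => ->.
by rewrite XY -eq1 KH.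
Qed.

(** The map th (u, c) = (T u, T c + S u u), a change of coordinates on T^2 M, has
    at 0 the derivative T (+) T and, S being symmetric, the second derivative
    (0, 2 S u v) in the directions (u, 0) and (v, 0). It therefore contributes the
    inhomogeneous term of the transformation law of Christoffel symbols. *)
Lemma christoffel_law (Ha Ka Hb Kb : E * E -> E * E) (T : clin E E) (S : E -> E -> E) :
  (forall e, smooth_at e Ha) -> (forall e, smooth_at e Ka) ->
  (forall e, smooth_at e Hb) -> (forall e, smooth_at e Kb) ->
  (forall e, Ka (Ha e) = e) -> (forall e, Ha (Ka e) = e) -> (forall e, Kb (Hb e) = e) ->
  bounded_bilinear S -> (forall u v, S u v = S v u) ->
  (forall u c, Hb (T u, T c + S u u) = (T (Ha (u, c)).1, T (Ha (u, c)).2)) ->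
  forall u v, christoffel Hb Kb (T u) (T v) + S u v = T (christoffel Ha Ka u v).
Proof.
move=> sHa sKa sHb sKb KHa HKa KHb hS symS equiv u v.
pose th (z : E * E) := (T z.1, T z.2 + S z.1 z.1).
pose T2 := clin_diag T.
have T2E p : T2 p = (T p.1, T p.2) by exact: clin_diagE.
have sid (z : E * E) := smooth_at_id z.
have s1 z : smooth_at z (fun z : E * E => z.1) by exact: smooth_at_fst (sid z).
have s2 z : smooth_at z (fun z : E * E => z.2) by exact: smooth_at_snd (sid z).
have sT1 z : smooth_at z (fun z : E * E => T z.1) by exact: smooth_at_clin_comp.
have sT2 z : smooth_at z (fun z : E * E => T z.2) by exact: smooth_at_clin_comp.
have sS z : smooth_at z (fun z : E * E => S z.1 z.1) by exact: smooth_at_bilinear.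
have sth z : smooth_at z th.
  by apply: smooth_at_pair => //; exact: smooth_atD.
have dif (F G : normedModType R) (z : F) (f : F -> G) := @smooth_at_differentiable _ _ _ z f.
have dT1 (z h : E * E) : dclin (fun z : E * E => T z.1) z h = T h.1.
  exact: etrans (dclin_post T (dif _ _ _ _ (s1 z)) h) (congr1 T (dclin_fst z h)).
have dT2 (z h : E * E) : dclin (fun z : E * E => T z.2) z h = T h.2.
  exact: etrans (dclin_post T (dif _ _ _ _ (s2 z)) h) (congr1 T (dclin_snd z h)).
have dS (z h : E * E) : dclin (fun z : E * E => S z.1 z.1) z h = S h.1 z.1 + S z.1 h.1.
  apply: etrans (dclin_bilinear hS (dif _ _ _ _ (s1 z)) (dif _ _ _ _ (s1 z)) h) _.
  by rewrite (dclin_fst z h).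
have dthE (z h : E * E) : dclin th z h = (T h.1, T h.2 + (S h.1 z.1 + S z.1 h.1)).
  apply: etrans (dclin_pair (dif _ _ _ _ (sT1 z)) (dif _ _ _ _ (smooth_atD (sT2 z) (sS z))) h) _.
  congr (_, _); first exact: dT1.
  apply: etrans (dclinD (dif _ _ _ _ (sT2 z)) (dif _ _ _ _ (sS z)) h) _.
  by congr (_ + _); [exact: dT2|exact: dS].
have th0 : th 0 = 0.
  by rewrite /th /= !linear0 (linear_fun0 (bilinr hS _)) addr0.
have eq1 : (fun z => Hb (th z)) = (fun z => T2 (Ha z)).
  by apply/funext => -[a c]; rewrite T2E /th /= equiv.
have scst (F G : normedModType R) (z : F) (c : G) := @smooth_at_cst _ F G z c.
have ddth : dclin (dclin th) 0 (u, 0) (v, 0) = (0, S u v + S u v).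
  rewrite (dclin2E (sth 0)).
  pose w (z : E * E) := (T v, S v z.1 + S z.1 v).
  rewrite (_ : (fun z => dclin th z (v, 0)) = w); last first.
    by apply/funext => z; rewrite dthE /= linear0 add0r.
  have s3 z : smooth_at z (fun z : E * E => S v z.1).
    by apply: (smooth_at_bilinear hS) => //; exact: scst.
  have s4 z : smooth_at z (fun z : E * E => S z.1 v).
    by apply: (smooth_at_bilinear hS) => //; exact: scst.
  have sw z : smooth_at z w by apply: smooth_at_pair; [exact: scst|exact: smooth_atD].
  have -> : dclin w 0 (u, 0) = (0, S u v + S u v).
    apply: etrans (dclin_pair (dif _ _ _ _ (scst _ _ 0 (T v)))
      (dif _ _ _ _ (smooth_atD (s3 0) (s4 0))) _) _.
    congr (_, _); first exact: dclin_cst.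
    apply: etrans (dclinD (dif _ _ _ _ (s3 0)) (dif _ _ _ _ (s4 0)) _) _.
    congr (_ + _).
      apply: etrans (dclin_bilinear hS (dif _ _ _ _ (scst _ _ 0 v)) (dif _ _ _ _ (s1 0)) _) _.
      by rewrite dclin_cst (dclin_fst 0 (u, 0)) (linear_fun0 (bilinl hS _)) add0r /= symS.
    apply: etrans (dclin_bilinear hS (dif _ _ _ _ (s1 0)) (dif _ _ _ _ (scst _ _ 0 v)) _) _.
    by rewrite dclin_cst (dclin_fst 0 (u, 0)) (linear_fun0 (bilinr hS _)) addr0.
  by [].
have dth0 h : dclin th 0 h = T2 h.
  rewrite dthE T2E /= (linear_fun0 (bilinr hS _)) (linear_fun0 (bilinl hS _)).
  by rewrite !addr0.
have := second_derivative_conjugate sHa sKa sHb sKb KHa HKa KHb sth th0 dth0 eq1 (u, 0) (v, 0).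
rewrite ddth !T2E /= !linear0 => /(congr1 (fun z : E * E => 2^-1 *: z.2)) /=.
have half (z : E) : 2^-1 *: (z + z) = z.
  by rewrite scalerDr -scalerDl -[X in (X + X) *: _]mul1r -splitr scale1r.
by rewrite scalerDr half /christoffel !clinZ /= => ->.
Qed.

End christoffel.

(** * Derivatives of curves in normed spaces *)

Section derivatives_along_curves.
Context {R : realType}.
Implicit Types E F G H : normedModType R.

Lemma derive1_eq F (f g : R -> F) t : (\forall s \near t, f s = g s) ->
  differentiable f t -> derive1 f t = derive1 g t.
Proof.
move=> fg df; have [dg _] := is_diff_near fg (dclinP df).
by rewrite !derive1_dclin// (dclin_eq fg).
Qed.

Lemma smooth_at_derive1 F (f : R -> F) t : smooth_at t f -> smooth_at t (derive1 f).
Proof.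
move=> sf; have := smooth_at_eval (smooth_at_dclin sf) (smooth_at_cst t (1 : R)).
apply: smooth_at_eq.
apply: filterS (smooth_at_near sf) => s /smooth_at_differentiable df.
by rewrite derive1_dclin.
Qed.

Lemma derive1n2_dclin F (f : R -> F) t : smooth_at t f ->
  derive1n 2 f t = dclin (dclin f) t 1 1.
Proof.
move=> sf; rewrite -[LHS]/(derive1 (derive1 f) t) (dclin2E sf).
have sd := smooth_at_eval (smooth_at_dclin sf) (smooth_at_cst t (1 : R)).
rewrite -derive1_dclin; last exact: smooth_at_differentiable.
apply: esym; apply: derive1_eq; last exact: smooth_at_differentiable.
apply: filterS (smooth_at_near sf) => s /smooth_at_differentiable df.
by rewrite derive1_dclin.
Qed.

Lemma derive1_clin_comp F G (f : R -> F) (g : F -> G) t :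
  differentiable f t -> differentiable g (f t) ->
  derive1 (fun s => g (f s)) t = dclin g (f t) (derive1 f t).
Proof.
move=> df dg; rewrite !derive1_dclin//; first exact: dclin_comp.
exact: (differentiable_comp df dg).
Qed.

Lemma derive1n2_clin_comp F G (f : R -> F) (g : F -> G) t :
  smooth_at t f -> smooth_at (f t) g ->
  derive1n 2 (fun s => g (f s)) t =
  dclin (dclin g) (f t) (derive1 f t) (derive1 f t) + dclin g (f t) (derive1n 2 f t).
Proof.
move=> sf sg; rewrite !derive1n2_dclin//; last exact: smooth_at_comp.
by rewrite (dclin2_comp sf sg) derive1_dclin//; exact: smooth_at_differentiable.
Qed.

Lemma smooth_at_shift F (f : R -> F) t s : smooth_at (t + s) f ->
  smooth_at s (fun r => f (t + r)) /\ derive1 (fun r => f (t + r)) s = derive1 f (t + s).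
Proof.
move=> sf; have st : smooth_at s (fun r => t + r).
  by apply: smooth_atD; [exact: smooth_at_cst|exact: smooth_at_id].
split; first exact: smooth_at_comp st sf.
rewrite (derive1_clin_comp (smooth_at_differentiable st) (smooth_at_differentiable sf)).
rewrite [RHS]derive1_dclin; last exact: smooth_at_differentiable.
congr (dclin f _ _); rewrite derive1_dclin; last exact: smooth_at_differentiable.
rewrite (@dclinD _ _ _ _ (fun=> t) id).
- rewrite dclin_cst add0r; have := dclin_clin (clin_id R) s.
  by rewrite clin_idE => ->; rewrite clin_idE.
- exact: smooth_at_differentiable (smooth_at_cst _ _).
- exact: smooth_at_differentiable (smooth_at_id _).
Qed.

(** A curve with prescribed value, velocity and acceleration at 0: such curves
    show that the charts of TM and T^2 M reach all fibre coordinates. *)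
Definition parabola F (y u c : F) (t : R) : F := y + (t *: u + (t * t) *: (2^-1 *: c)).

Lemma parabolaP F (y u c : F) : [/\ forall t, smooth_at t (parabola y u c),
  parabola y u c 0 = y, derive1 (parabola y u c) 0 = u & derive1n 2 (parabola y u c) 0 = c].
Proof.
have sid t : smooth_at t (fun s : R => s) by exact: smooth_at_id.
have scst (z : F) (t : R) : smooth_at t (fun _ : R => z) by exact: smooth_at_cst.
have did t : differentiable (fun s : R => s) t by exact: smooth_at_differentiable (sid t).
have bs := @bounded_bilinear_scale R F.
have bm := @bounded_bilinear_scale R R.
pose v := 2^-1 *: c.
have s1 t : smooth_at t (fun s : R => s *: u) by exact: smooth_at_bilinear bs (sid t) (scst _ t).
have ssq t : smooth_at t (fun s : R => s * s) by exact: smooth_at_bilinear bm (sid t) (sid t).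
have s2 t : smooth_at t (fun s : R => (s * s) *: v) by exact: smooth_at_bilinear bs (ssq t) (scst _ t).
have s12 t := smooth_atD (s1 t) (s2 t).
have sp t : smooth_at t (parabola y u c) := smooth_atD (scst y t) (s12 t).
have dif (G : normedModType R) (t : R) (f : R -> G) := @smooth_at_differentiable _ _ _ t f.
have dlin (z : F) (t : R) : dclin (fun s : R => s *: z) t 1 = z.
  apply: etrans (dclin_bilinear bs (did t) (dif _ _ _ (scst z t)) 1) _.
  rewrite dclin_cst scaler0 addr0; have := dclin_clin (clin_id R) t.
  by rewrite clin_idE => ->; rewrite clin_idE scale1r.
have dsq t : dclin (fun s : R => s * s) t 1 = t + t.
  apply: etrans (dclin_bilinear bm (did t) (did t) 1) _.
  have := dclin_clin (clin_id R) t; rewrite clin_idE => ->; rewrite clin_idE.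
  by rewrite scale1r [_ *: _]mulr1.
have dp t : derive1 (parabola y u c) t = u + (t + t) *: v.
  rewrite derive1_dclin; last exact: dif.
  apply: etrans (dclinD (dif _ _ _ (scst y t)) (dif _ _ _ (s12 t)) 1) _.
  rewrite dclin_cst add0r.
  apply: etrans (dclinD (dif _ _ _ (s1 t)) (dif _ _ _ (s2 t)) 1) _.
  congr (_ + _); first exact: dlin.
  apply: etrans (dclin_bilinear bs (dif _ _ _ (ssq t)) (dif _ _ _ (scst v t)) 1) _.
  by rewrite dclin_cst scaler0 addr0 dsq.
split=> //.
- by rewrite /parabola mulr0 !scale0r !addr0.
- by rewrite dp addr0 scale0r addr0.
- rewrite -[LHS]/(derive1 (derive1 _) 0) (_ : derive1 (parabola y u c) = fun t => u + t *: c); last first.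
    apply/funext => t; rewrite dp /v scalerA; congr (_ + _ *: _).
    by rewrite mulrDl -splitr.
  have s3 (t : R) : smooth_at t (fun s : R => s *: c) by exact: smooth_at_bilinear bs (sid t) (scst _ t).
  rewrite derive1_dclin; last exact: dif (smooth_atD (scst u 0) (s3 0)).
  apply: etrans (dclinD (dif _ _ _ (scst u 0)) (dif _ _ _ (s3 0)) 1) _.
  by rewrite dclin_cst add0r dlin.
Qed.

End derivatives_along_curves.

(** * Curves in a manifold and their velocities *)

Section curves.
Context {R : realType} {E : normedModType R}.
Implicit Type M : atlas E.

(** The condition of smooth_curve_on at a single instant, in germs. *)
Definition smooth_curve_at M (f : R -> M) (t : R) : Prop := forall a : idx M,
  dom a (f t) -> (\forall s \near t, dom a (f s)) /\ smooth_at t (chart a \o f).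

Lemma smooth_curve_onP M (J : set R) (f : R -> M) : open J ->
  smooth_curve_on J f <-> forall t, J t -> smooth_curve_at f t.
Proof.
move=> oJ; split=> [cf t Jt a fta|cf a].
  have [oJa sJa] := cf a; split; last by exists (J `&` f @^-1` dom a).
  by apply: filterS (open_nbhs_nbhs (conj oJa (conj Jt fta))) => s [].
have oJa : open (J `&` f @^-1` dom a).
  rewrite openE => t [Jt fta]; apply: filterI; first exact: open_nbhs_nbhs.
  by have [] := cf t Jt a fta.
by split=> //; apply/smooth_onP => // t [Jt fta]; have [] := cf t Jt a fta.
Qed.

Lemma is_curveP M (f : R -> M) : is_curve f <-> \forall t \near (0 : R), smooth_curve_at f t.
Proof.
split=> [[e e0 /(smooth_curve_onP _ (interval_open _ _)) H]|/nbhs_normP[e e0 H]].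
  have e0' : (0 : R) \in `](- e), e[ by rewrite in_itv/= oppr_lt0 e0.
  by apply: filterS (near_in_itvoo e0') => t; exact: H.
exists e => //; apply/smooth_curve_onP => [|t]; first exact: interval_open.
rewrite /= in_itv/= => /andP[et te]; apply: H; rewrite /= sub0r normrN.
by rewrite ltr_norml et.
Qed.

Lemma curve_smooth_at M (c : curve M) : smooth_curve_at c 0.
Proof. by have /is_curveP/nbhs_singleton := curveP c. Qed.

Lemma smooth_curve_at_shift M (f : R -> M) t s :
  smooth_curve_at f (t + s) -> smooth_curve_at (fun r => f (t + r)) s.
Proof.
move=> cf a /cf[near_a sa]; split; last by have [] := smooth_at_shift sa.
have cs : {for s, continuous (fun r => t + r)}.
  by apply: smooth_at_continuous; apply: smooth_atD; [exact: smooth_at_cst|exact: smooth_at_id].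
exact: cs near_a.
Qed.

Lemma is_curve_shift M (f : R -> M) : is_curve f ->
  \forall t \near (0 : R), is_curve (fun s => f (t + s)).
Proof.
move=> /is_curveP /near_join; apply: filterS => t near_t; apply/is_curveP.
move/nbhs0P: near_t; apply: filterS => s; exact: smooth_curve_at_shift.
Qed.

Lemma tangent_reprP M (c : curve M) (d := repr (\pi_(TM M) c)) : d 0 = c 0 /\
  forall a, dom a (c 0) -> derive1 (chart a \o d) 0 = derive1 (chart a \o c) 0.
Proof.
have /asboolP[dc H] : tangent_eq d c by apply/eqmodP; rewrite reprK.
by split=> // a ac; apply: H; rewrite dc.
Qed.

Lemma tproj_pi M (c : curve M) : tproj M (\pi c) = c 0.
Proof. by have [] := tangent_reprP c. Qed.

Lemma tcoord_pi M (c : curve M) a : dom a (c 0) ->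
  tcoord a (\pi_(TM M) c) = derive1 (chart a \o c) 0.
Proof. by have [_] := tangent_reprP c; apply. Qed.

(** The second hypothesis selects the branch of velocity that is not the junk
    value. *)
Lemma velocityP M (f : R -> M) t : smooth_curve_at f t -> is_curve (fun s => f (t + s)) ->
  tproj M (velocity f t) = f t /\
  forall a, dom a (f t) -> tcoord a (velocity f t) = derive1 (chart a \o f) t.
Proof.
move=> ft cft; rewrite /velocity; case: pselect => // h; rewrite tproj_pi /= addr0.
split=> // a /[dup] fta /ft[_ sf]; rewrite tcoord_pi /= ?addr0//.
have sf0 : smooth_at (t + 0) (chart a \o f) by rewrite addr0.
by have [_] := smooth_at_shift sf0; rewrite [in RHS]addr0.
Qed.

Lemma near_velocityP M (f : R -> M) : is_curve f -> \forall t \near (0 : R),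
  tproj M (velocity f t) = f t /\
  forall a, dom a (f t) -> tcoord a (velocity f t) = derive1 (chart a \o f) t.
Proof.
move=> cf; have /is_curveP cf' := cf.
by apply: filterS2 cf' (is_curve_shift cf) => t; exact: velocityP.
Qed.

End curves.

Section second_order_classes.
Context {R : realType} {E : normedModType R}.
Implicit Type M : atlas E.

(** As velocity f is a curve in TM, its velocity at 0, which second_order_eq
    compares, is the genuine f''(0) and not a junk value. *)
Lemma velocity_curve M (f : R -> M) : is_curve f -> is_curve (velocity f : R -> tangent M).
Proof.
move=> cf; apply/is_curveP; have /is_curveP cf' := cf.
apply: filterS2 cf' (near_join (near_velocityP cf)) => t cft near_t a.
have [pt _] := nbhs_singleton near_t.
rewrite /= pt => fta; have [near_a sa] := cft a fta; split.
  by apply: filterS2 near_t near_a => s [-> _].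
have := smooth_at_pair sa (smooth_at_derive1 sa); apply: smooth_at_eq.
apply: filterS2 near_t near_a => s [ps cs] fsa; rewrite /= ps cs//.
Qed.

(** In the chart of T(TM), f''(0) has the coordinates ((psi o f)', (psi o f)'')
    at 0; hence the coordinates on T^2 M do not depend on the curve chosen in a
    class. *)
Lemma second_order_reprP M (c : curve M) (d := repr (\pi_(T2M M) c)) : d 0 = c 0 /\
  forall a, dom a (c 0) -> derive1 (chart a \o d) 0 = derive1 (chart a \o c) 0 /\
    derive1n 2 (chart a \o d) 0 = derive1n 2 (chart a \o c) 0.
Proof.
have /asboolP[v1 v2] : second_order_eq d c by apply/eqmodP; rewrite reprK.
have Vd := near_velocityP (curveP d); have Vc := near_velocityP (curveP c).
have [pd td] := nbhs_singleton Vd; have [pc tc] := nbhs_singleton Vc.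
have dc : d 0 = c 0 by rewrite -pd v1 pc.
split; first exact: dc.
move=> a ac; have ad : dom a (d 0) by rewrite dc.
split; first by rewrite -td// v1 tc.
have acc (e : curve M) : dom a (e 0) -> (\forall t \near (0 : R),
   tproj M (velocity e t) = e t /\
   forall a, dom a (e t) -> tcoord a (velocity e t) = derive1 (chart a \o e) t) ->
   tcoord (M := tangent M) a (velocity (velocity e : R -> tangent M) 0) =
   (derive1 (chart a \o e) 0, derive1n 2 (chart a \o e) 0).
  move=> ae Ve; have cv := velocity_curve (curveP e).
  have [pv tv] := nbhs_singleton (near_velocityP cv).
  have [p0 t0] := nbhs_singleton Ve.
  rewrite tv /= ?p0//; have [near_a sa] := curve_smooth_at ae.
  have sda := smooth_at_derive1 sa.
  have dsa := smooth_at_differentiable sa; have dsda := smooth_at_differentiable sda.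
  rewrite -(@derive1_eq _ _ (fun t => (chart a (e t), derive1 (chart a \o e) t))).
  - rewrite !derive1_dclin//; last exact: smooth_at_differentiable (smooth_at_pair sa sda).
    by apply: etrans (dclin_pair dsa dsda 1) _; rewrite -!derive1_dclin.
  - by apply: filterS2 Ve near_a => s [ps cs] esa; rewrite /= ps cs.
  - exact: smooth_at_differentiable (smooth_at_pair sa sda).
have := etrans (esym (acc _ ad Vd)) (etrans (congr1 (tcoord (M := tangent M) a) v2) (acc _ ac Vc)).
by case.
Qed.

End second_order_classes.

(** * Coordinates on the first and second order tangent bundles *)

Section manifold_theory.
Context {R : realType} {E : normedModType R} (M : atlas E) (hM : is_manifold M).

Lemma atlas_cover (x : M) : exists a : idx M, dom a x.
Proof. by case: hM. Qed.

Lemma chart_inj (a : idx M) (x y : M) : dom a x -> dom a y -> chart a x = chart a y -> x = y.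
Proof. by case: hM => _ + _ _; exact. Qed.

Lemma open_chart_dom2 (a b : idx M) : open (chart a @` (dom a `&` dom b)).
Proof. by case: hM. Qed.

Lemma open_chart_dom (a : idx M) : open (chart a @` dom a).
Proof. by have := open_chart_dom2 a a; rewrite setIid. Qed.

Lemma near_chart_dom (a : idx M) (x : M) : dom a x ->
  \forall y \near chart a x, (chart a @` dom a) y.
Proof.
by move=> ax; apply: open_nbhs_nbhs; split; [exact: open_chart_dom|exists x].
Qed.

(** One of the transition maps given by is_manifold. Only its germs at the points
    of the overlap are determined by the atlas. *)
Definition transition (a b : idx M) : E -> E :=
  let: And4 _ _ _ h := hM in sval (cid2 (h b a)).

Lemma transition_smooth_on (a b : idx M) :
  smooth_on (chart a @` (dom a `&` dom b)) (transition a b).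
Proof. by rewrite /transition; case: hM => _ _ _ h; case: cid2 => s /=; rewrite setIC. Qed.

Lemma transitionE (a b : idx M) x : dom a x -> dom b x ->
  transition a b (chart a x) = chart b x.
Proof.
by move=> ax bx; rewrite /transition; case: hM => _ _ _ h; case: cid2 => s /= _ ->.
Qed.

Lemma transition_smooth (a b : idx M) x : dom a x -> dom b x ->
  smooth_at (chart a x) (transition a b).
Proof.
move=> ax bx; apply: smooth_at_on (transition_smooth_on a b); last by exists x.
exact: open_chart_dom2.
Qed.

Lemma near_transition (a b : idx M) x : dom a x -> dom b x ->
  \forall y \near chart a x, exists z,
    [/\ dom a z, dom b z, chart a z = y & transition a b y = chart b z].
Proof.
move=> ax bx; apply: filterS (open_nbhs_nbhs (conj (open_chart_dom2 a b) _)); last by exists x.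
by move=> _ [z [az bz] <-]; exists z; rewrite transitionE.
Qed.

(** One chart around f t suffices: the overlap with any other chart has an open
    image, and the transition map is smooth there. *)
Lemma smooth_curve_at_chart (f : R -> M) (t : R) (a : idx M) (g : R -> E) : dom a (f t) ->
  (\forall s \near t, dom a (f s) /\ chart a (f s) = g s) -> smooth_at t g ->
  smooth_curve_at f t.
Proof.
move=> aft near_g sg b bft.
have gt : g t = chart a (f t) by have [] := nbhs_singleton near_g.
have near_b : \forall s \near t, [/\ dom a (f s), dom b (f s) & chart a (f s) = g s].
  have := near_transition aft bft; rewrite -gt => near_tr.
  have := smooth_at_continuous sg near_tr; apply: filterS2 near_g => s [afs gs].
  move=> [z [az bz zE _]]; split=> //.
  by rewrite (@chart_inj a (f s) z)// gs.
split; first by apply: filterS near_b => s [].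
have : smooth_at t (fun s => transition a b (g s)).
  by apply: smooth_at_comp sg _; rewrite gt; exact: transition_smooth.
apply: smooth_at_eq; apply: filterS near_b => s [afs bfs <-].
exact: transitionE.
Qed.

(** The curve is the lift of g through the chart while g stays in its image; it is
    smooth in the other charts by smooth_curve_at_chart. *)
Lemma exists_curve_in_chart (a : idx M) (x : M) (g : R -> E) : dom a x ->
  (forall t, smooth_at t g) -> g 0 = chart a x ->
  exists c : curve M, c 0 = x /\ \forall t \near (0 : R), dom a (c t) /\ chart a (c t) = g t.
Proof.
move=> ax sg g0.
(* Outside the image of the chart the constant x serves as a default. *)
pose f (t : R) : M :=
  if pselect (exists2 z, dom a z & chart a z = g t) is left h then s2val (cid2 h) else x.
have fP t : (chart a @` dom a) (g t) -> dom a (f t) /\ chart a (f t) = g t.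
  by rewrite /f => ?; case: pselect => // h; case: cid2.
have near_f t : (chart a @` dom a) (g t) -> \forall s \near t, dom a (f s) /\ chart a (f s) = g s.
  move=> [z az zE].
  have near_g : \forall s \near t, (chart a @` dom a) (g s).
    by apply: (smooth_at_continuous (sg t)); rewrite -zE; exact: near_chart_dom.
  by apply: filterS near_g => s /fP.
have g0a : (chart a @` dom a) (g 0) by exists x.
have f0 : f 0 = x.
  by have [af0 fg0] := fP _ g0a; apply: (@chart_inj a) => //; rewrite fg0.
have cf : is_curve f.
  have near_g : \forall t \near (0 : R), (chart a @` dom a) (g t).
    by apply: (smooth_at_continuous (sg 0)); rewrite g0; exact: near_chart_dom.
  apply/is_curveP; apply: filterS near_g => t gta; have [aft _] := fP _ gta.
  exact: smooth_curve_at_chart aft (near_f _ gta) (sg t).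
by exists (Curve cf); split=> //=; exact: near_f.
Qed.

(** First and second order chain rule for psi_b o c = sigma o (psi_a o c). *)
Lemma curve_coord_change (c : curve M) (a b : idx M) : dom a (c 0) -> dom b (c 0) ->
  [/\ derive1 (chart b \o c) 0 =
        dclin (transition a b) (chart a (c 0)) (derive1 (chart a \o c) 0) &
      derive1n 2 (chart b \o c) 0 =
        dclin (dclin (transition a b)) (chart a (c 0))
          (derive1 (chart a \o c) 0) (derive1 (chart a \o c) 0) +
        dclin (transition a b) (chart a (c 0)) (derive1n 2 (chart a \o c) 0)].
Proof.
move=> ac bc; have [near_a sa] := curve_smooth_at ac.
have [near_b sb] := curve_smooth_at bc.
have st := transition_smooth ac bc.
have scomp : smooth_at 0 (fun t => transition a b ((chart a \o c) t)) by exact: smooth_at_comp.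
have near_eq : \forall t \near (0 : R), transition a b ((chart a \o c) t) = (chart b \o c) t.
  by apply: filterS2 near_a near_b => t; exact: transitionE.
split.
  rewrite -(derive1_eq near_eq (smooth_at_differentiable scomp)).
  exact: derive1_clin_comp (smooth_at_differentiable sa) (smooth_at_differentiable st).
rewrite -(derive1n2_clin_comp sa st) !derive1n2_dclin//.
have near_d : \forall t \near (0 : R), dclin (chart b \o c) t =
    dclin (fun t => transition a b ((chart a \o c) t)) t.
  apply: filterS2 (near_join near_eq) (smooth_at_near scomp) => t e /smooth_at_differentiable d.
  by rewrite (dclin_eq e).
rewrite (dclin_eq near_d)//; exact: smooth_at_differentiable (smooth_at_dclin sb).
Qed.

Lemma tcoord_change (v : TM M) (a b : idx M) : dom a (tproj M v) -> dom b (tproj M v) ->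
  tcoord b v = dclin (transition a b) (chart a (tproj M v)) (tcoord a v).
Proof. by move=> av bv; have [] := curve_coord_change av bv. Qed.

Lemma tangent_inj (v w : TM M) (a : idx M) : tproj M v = tproj M w -> dom a (tproj M v) ->
  tcoord a v = tcoord a w -> v = w.
Proof.
move=> vw av avw; rewrite -(reprK v) -(reprK w); apply/eqmodP/asboolP; split=> // b bv.
rewrite -!/(tcoord b _) (tcoord_change av)// (@tcoord_change w a b) -?vw//.
by rewrite avw.
Qed.

Lemma tangent_surj (a : idx M) (x : M) (u : E) : dom a x ->
  exists v : TM M, tproj M v = x /\ tcoord a v = u.
Proof.
move=> ax; have [sp p0 p1 _] := parabolaP (chart a x) u 0.
have [c [c0 near_c]] := exists_curve_in_chart ax sp p0.
exists (\pi c); rewrite tproj_pi tcoord_pi ?c0//; split=> //.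
rewrite -[RHS]p1; apply: esym; apply: derive1_eq; last exact: smooth_at_differentiable.
by apply: filterS near_c => t [].
Qed.

Lemma second_order_coord_change (z : T2M M) (a b : idx M) u c :
  dom a (proj2M M z) -> dom b (proj2M M z) ->
  (@chart _ _ (tangent2 M) a z).2 = (u, c) ->
  let s := transition a b in let y := chart a (proj2M M z) in
  (@chart _ _ (tangent2 M) b z).2 = (dclin s y u, dclin (dclin s) y u u + dclin s y c).
Proof.
move=> az bz uc; rewrite -[u]/((u, c).1) -[c]/((u, c).2) -uc.
by have [e1 e2] := curve_coord_change az bz; congr (_, _).
Qed.

Lemma tangent2_surj (a : idx M) (x : M) (u c : E) : dom a x ->
  exists z : T2M M, proj2M M z = x /\ (@chart _ _ (tangent2 M) a z).2 = (u, c).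
Proof.
move=> ax; have [sp p0 p1 p2] := parabolaP (chart a x) u c.
have [d [d0 near_d]] := exists_curve_in_chart ax sp p0.
have ad : dom a (d 0) by rewrite d0.
have [r0 r1] := second_order_reprP d; have [ra rb] := r1 a ad.
exists (\pi d); rewrite /proj2M r0 d0; split=> //.
transitivity (derive1 (chart a \o d) 0, derive1n 2 (chart a \o d) 0).
  by congr (_, _); [exact: ra|exact: rb].
have [_ sa] := curve_smooth_at ad.
have near_e : \forall t \near (0 : R), parabola (chart a x) u c t = (chart a \o d) t.
  by apply: filterS near_d => t [].
congr (_, _).
  by rewrite -p1; apply: esym; exact: (derive1_eq near_e (smooth_at_differentiable (sp 0))).
rewrite -p2 !derive1n2_dclin//.
have near_f : \forall t \near (0 : R), dclin (parabola (chart a x) u c) t = dclin (chart a \o d) t.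
  apply: filterS (near_join near_e) => t e.
  exact: dclin_eq e (smooth_at_differentiable (sp t)).
by rewrite (dclin_eq near_f (smooth_at_differentiable (smooth_at_dclin (sp 0)))).
Qed.

End manifold_theory.

(** * The tangent bundle as a manifold *)

Section tangent_manifold.
Context {R : realType} {E : normedModType R} (M : atlas E) (hM : is_manifold M).

Lemma tangent_chart_image (a b : idx M) :
  @chart _ _ (tangent M) a @` (@dom _ _ (tangent M) a `&` @dom _ _ (tangent M) b) =
  [set p : E * E | (chart a @` (dom a `&` dom b)) p.1].
Proof.
apply/seteqP; split=> [_ [v [av bv] <-]|[y u] [x [ax bx] xy]] /=.
  by exists (tproj M v).
have [v [vx vu]] := tangent_surj hM u ax.
move: xy => /= <-; exists v; first by split; rewrite /= vx.
by rewrite /= vx vu.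
Qed.

Definition tangent_transition (a b : idx M) (p : E * E) : E * E :=
  (transition hM a b p.1, dclin (transition hM a b) p.1 p.2).

Lemma transition_fst_smooth (F : normedModType R) (a b : idx M) x (u : F) : dom a x -> dom b x ->
  smooth_at (chart a x, u) (fun p : E * F => transition hM a b p.1).
Proof.
move=> ax bx; apply: (smooth_at_comp (smooth_at_fst_id (chart a x, u))).
exact: transition_smooth.
Qed.

Lemma dtransition_fst_smooth (F : normedModType R) (a b : idx M) x (u : F) : dom a x -> dom b x ->
  smooth_at (chart a x, u) (fun p : E * F => dclin (transition hM a b) p.1).
Proof.
move=> ax bx; apply: (smooth_at_comp (smooth_at_fst_id (chart a x, u))).
by apply: smooth_at_dclin; exact: transition_smooth.
Qed.

Lemma tangent_transition_smooth (a b : idx M) x (u : E) : dom a x -> dom b x ->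
  smooth_at (chart a x, u) (tangent_transition a b).
Proof.
move=> ax bx; apply: smooth_at_pair; first exact: transition_fst_smooth.
by apply: smooth_at_eval; [exact: dtransition_fst_smooth|exact: smooth_at_snd_id].
Qed.

Lemma tangent_transitionE (a b : idx M) (v : tangent M) :
  dom a (tproj M v) -> dom b (tproj M v) ->
  tangent_transition a b (chart a (tproj M v), tcoord a v) = (chart b (tproj M v), tcoord b v).
Proof. by move=> av bv; rewrite /tangent_transition/= transitionE// (tcoord_change hM av bv). Qed.

(** Since T(TM) is the tangent bundle of the manifold TM, coordinate changes and
    surjectivity of charts on T(TM) become instances of those on TM. *)
Lemma tangent_is_manifold : is_manifold (tangent M).
Proof.
split=> [v|a v w|a b|a b].
- by have [a av] := atlas_cover hM (tproj M v); exists a.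
- move=> /= av aw [vw1 vw2]; apply: (tangent_inj hM) vw2 => //.
  exact: (chart_inj hM av aw).
- rewrite tangent_chart_image; exact/open_fst_preimage/open_chart_dom2.
- exists (tangent_transition b a); last first.
    by move=> v [av bv] /=; rewrite tangent_transitionE.
  rewrite setIC; apply/smooth_onP.
    rewrite tangent_chart_image; exact/open_fst_preimage/open_chart_dom2.
  by move=> _ [v [bv av] <-]; exact: tangent_transition_smooth.
Qed.

Lemma dclin_tangent_transition (a b : idx M) x (u v r : E) : dom a x -> dom b x ->
  let s := transition hM a b in let y := chart a x in
  dclin (tangent_transition a b) (y, u) (v, r) =
  (dclin s y v, dclin (dclin s) y v u + dclin s y r).
Proof.
move=> ax bx s y.
have dif (F G : normedModType R) (z : F) (f : F -> G) := @smooth_at_differentiable _ _ _ z f.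
have ss : smooth_at y s by exact: transition_smooth.
have s1 := dif _ _ _ _ (smooth_at_fst_id (y, u)).
have s2 := dif _ _ _ _ (smooth_at_snd_id (y, u)).
have sp := transition_fst_smooth u ax bx.
have sd := dtransition_fst_smooth u ax bx.
have se := smooth_at_eval sd (smooth_at_snd_id (y, u)).
apply: etrans (dclin_pair (dif _ _ _ _ sp) (dif _ _ _ _ se) (v, r)) _.
have c1 := dclin_comp s1 (dif _ _ _ _ ss) (v, r).
have c2 := dclin_comp s1 (dif _ _ _ _ (smooth_at_dclin ss)) (v, r).
congr (_, _); first by apply: etrans c1 _; rewrite (dclin_fst (y, u) (v, r)).
apply: etrans (dclin_eval (dif _ _ _ _ sd) s2 (v, r)) _.
rewrite (dclin_snd (y, u) (v, r)); congr (_ + _).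
by apply: etrans (congr1 (fun A : clin E E => A u) c2) _; rewrite (dclin_fst (y, u) (v, r)).
Qed.

(** This is tcoord_change for the manifold TM, whose transition maps have the
    germs of tangent_transition. *)
Lemma double_tangent_change (z : TM (tangent M)) (a b : idx M)
    (x := tproj M (tproj (tangent M) z)) :
  dom a x -> dom b x ->
  let s := transition hM a b in let y := chart a x in
  let u := tcoord a (tproj (tangent M) z) in
  let w := tcoord (M := tangent M) a z in
  tcoord (M := tangent M) b z = (dclin s y w.1, dclin (dclin s) y w.1 u + dclin s y w.2).
Proof.
move=> ax bx s y u w.
have := @tcoord_change _ _ _ tangent_is_manifold z a b ax bx.
rewrite -[tcoord (M := tangent M) a z]/w => ->.
rewrite -(dclin_tangent_transition u w.1 w.2 ax bx).
rewrite (_ : @chart _ _ (tangent M) a (tproj (tangent M) z) = (y, u))//.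
have -> : (w.1, w.2) = w by case: w.
congr (clin_fun _ w); apply: esym; apply: dclin_eq; last first.
  exact: smooth_at_differentiable (tangent_transition_smooth u ax bx).
have := @near_transition _ _ _ tangent_is_manifold a b (tproj (tangent M) z) ax bx.
apply: filterS => p [v [av bv <- ->]]; exact: tangent_transitionE.
Qed.

Lemma double_tangent_surj (a : idx M) (x : M) (u v r : E) : dom a x ->
  exists z : TM (tangent M), [/\ tproj M (tproj (tangent M) z) = x,
    tcoord a (tproj (tangent M) z) = u & tcoord (M := tangent M) a z = (v, r)].
Proof.
move=> ax; have [t [tx tu]] := tangent_surj hM u ax.
have at_ : @dom _ _ (tangent M) a t by rewrite /= tx.
have [z [zt zv]] := tangent_surj tangent_is_manifold (v, r) at_.
by exists z; rewrite zt.
Qed.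

End tangent_manifold.

(** * Local forms of the isomorphism *)

Section local_trivialization.
Context {R : realType} {E : normedModType R} (M : atlas E) (hM : is_manifold M).
Notation TMxTM := (fib_prod (tproj M) (tproj M)).
Variables (V : vbundle (proj2M M) (E * E)%type).
Hypothesis hV : smooth_vbundle (tangent2 M) V.

Definition fib_coord (a : idx M) (z : TMxTM) : E * E :=
  (tcoord a (sval z).1, tcoord a (sval z).2).

Lemma fib_proj2 (z : TMxTM) : tproj M (sval z).2 = fib_proj z.
Proof. by case: z => p vw; exact: esym vw. Qed.

Lemma fib_surj (a : idx M) (x : M) (e : E * E) : dom a x ->
  exists z : TMxTM, fib_proj z = x /\ fib_coord a z = e.
Proof.
move=> ax; have [v [vx ve]] := tangent_surj hM e.1 ax.
have [w [wx we]] := tangent_surj hM e.2 ax.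
have vw : tproj M v = tproj M w by rewrite vx wx.
exists (exist (fun p : TM M * TM M => tproj M p.1 = tproj M p.2) (v, w) vw).
by split=> //; rewrite /fib_coord [LHS](f_equal2 pair ve we) -surjective_pairing.
Qed.

Lemma fib_image (a : idx M) :
  (fun z : TMxTM => (chart a (fib_proj z), fib_coord a z)) @` (@fib_proj _ _ _ _ _ @^-1` dom a) =
  [set p : E * (E * E) | (chart a @` dom a) p.1].
Proof.
apply/seteqP; split=> [_ [z az <-]|[y e] [x ax /= <-]] /=; first by exists (fib_proj z).
by have [z [zx ze]] := fib_surj e ax; exists z; rewrite /= zx ?ze.
Qed.

Lemma tangent2_chart_image (a : idx M) :
  @chart _ _ (tangent2 M) a @` (proj2M M @^-1` dom a) =
  [set p : E * (E * E) | (chart a @` dom a) p.1].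
Proof.
apply/seteqP; split=> [_ [z az <-]|[y [u c]] [x ax /= <-]]; first by exists (proj2M M z).
have [z [zx ze]] := tangent2_surj hM u c ax; exists z; first by rewrite /= zx.
by rewrite -ze -zx.
Qed.

Lemma msmooth_on_chart (F : normedModType R) (A : set M) (g : M -> F) (a : idx M) x :
  msmooth_on A g -> dom a x -> A x ->
  exists s : E -> F, smooth_at (chart a x) s /\
    \forall y \near chart a x, forall z, dom a z -> chart a z = y -> A z /\ g z = s y.
Proof.
move=> [oA sA] ax Ax; have [s ss sE] := sA a; exists s.
have xA : (chart a @` (dom a `&` A)) (chart a x) by exists x.
split; first exact: smooth_at_on (oA a) xA ss.
apply: filterS (open_nbhs_nbhs (conj (oA a) xA)) => _ [t [at_ At] <-] z az zt.
have -> : z = t by exact: (chart_inj hM az at_ zt).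
by rewrite (sE _ (conj at_ At)).
Qed.

(** Near a point, h read in charts is a composition of smooth maps: from the chart
    of T^2 M to a trivialization of V, through the fibrewise linear map given by
    the morphism, to the charts b and c of the two factors TM, and from these
    to the chart a. *)
Lemma forward_local_form (h : T2M M -> TMxTM) (a : idx M) :
  vb_morphism V (vb_prod (tangent_vb M) (tangent_vb M)) id h ->
  exists H : E * (E * E) -> E * E, forall z, (proj2M M @^-1` dom a) z ->
    smooth_at (@chart _ _ (tangent2 M) a z) H /\
    fib_coord a (h z) = H (@chart _ _ (tangent2 M) a z).
Proof.
move=> [_ hp hloc]; apply: smooth_glue.
  by rewrite tangent2_chart_image; exact/open_fst_preimage/open_chart_dom.
move=> z0 az0; set x0 := proj2M M z0.
have [j [[b c] [/= jx [bx cx] [g sg gE]]]] := hloc x0.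
have [sg' [ssg near_g]] := msmooth_on_chart sg az0 (conj jx (conj bx cx)).
have [_ hid _] := hV; have [oid [s ss sE]] := hid a (a, j).
set P := @chart _ _ (tangent2 M) a.
have sP : smooth_at (P z0) s.
  by apply: smooth_at_on oid _ ss; exists z0.
pose q (p : E * (E * E)) := sg' p.1 (s p).2.
have sq : smooth_at (P z0) q.
  apply: smooth_at_eval; last exact: smooth_at_snd.
  by apply: smooth_at_comp (smooth_at_fst_id _) _.
pose T (d : idx M) (p : E * (E * E)) := dclin (transition hM d a) (transition hM a d p.1).
have sT d : dom d x0 -> smooth_at (P z0) (T d).
  move=> dx; apply: smooth_at_comp (transition_fst_smooth hM _ az0 dx) _.
  by rewrite /= transitionE//; apply: smooth_at_dclin; exact: transition_smooth.
exists (fun p => (T b p (q p).1, T c p (q p).2)).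
  apply: smooth_at_pair.
    exact: smooth_at_eval (sT b bx) (smooth_at_fst sq).
  exact: smooth_at_eval (sT c cx) (smooth_at_snd sq).
have near_g' : \forall p \near P z0, forall z, dom a z -> chart a z = p.1 ->
    (vdom j `&` id @^-1` (dom b `&` dom c)) z /\ g z = sg' p.1.
  exact: (smooth_at_continuous (smooth_at_fst_id (P z0)) near_g).
apply: filterS near_g' => p near_p z az zp.
have [[jz [bz cz]] gz] := near_p (proj2M M z) az (congr1 fst zp).
have := gE z (conj jz (conj bz cz)).
have := congr1 snd (sE z (conj az (conj az jz))); rewrite /= -/P -/(P z) zp => trivE.
rewrite gz trivE -/(q p) => qE; have q1 := congr1 fst qE; have q2 := congr1 snd qE.
have TE d (v : TM M) : tproj M v = proj2M M z -> dom d (proj2M M z) ->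
    tcoord a v = T d p (tcoord d v).
  move=> vz dz; rewrite /T -zp /= transitionE// -vz.
  by apply: tcoord_change; rewrite vz.
congr (_, _); rewrite /= -?q1 -?q2 -?TE//; first by rewrite -hp.
by rewrite fib_proj2 -hp.
Qed.

(** The same composition in the opposite direction. *)
Lemma backward_local_form (h : TMxTM -> T2M M) (a : idx M) :
  vb_morphism (vb_prod (tangent_vb M) (tangent_vb M)) V id h ->
  exists K : E * (E * E) -> E * E, forall z, (@fib_proj _ _ _ _ _ @^-1` dom a) z ->
    smooth_at (chart a (fib_proj z), fib_coord a z) K /\
    (@chart _ _ (tangent2 M) a (h z)).2 = K (chart a (fib_proj z), fib_coord a z).
Proof.
move=> [_ hp hloc]; apply: smooth_glue.
  by rewrite fib_image; exact/open_fst_preimage/open_chart_dom.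
move=> z0 az0; set x0 := fib_proj z0.
have [[b c] [j [/= [bx cx] jx [g sg gE]]]] := hloc x0.
have [sg' [ssg near_g]] := msmooth_on_chart sg az0 (conj (conj bx cx) jx).
have [_ _ hid] := hV; have [oid [s ss sE]] := hid (a, j) a.
set P := fun z => (chart a (fib_proj z), fib_coord a z).
pose T (d : idx M) (p : E * (E * E)) := dclin (transition hM a d) p.1.
have sT d : dom d x0 -> smooth_at (P z0) (T d).
  by move=> dx; exact: (dtransition_fst_smooth hM _ az0 dx).
pose q (p : E * (E * E)) := (p.1, sg' p.1 (T b p p.2.1, T c p p.2.2)).
have sq : smooth_at (P z0) q.
  apply: smooth_at_pair; first exact: smooth_at_fst_id.
  apply: smooth_at_eval; first exact: smooth_at_comp (smooth_at_fst_id _) _.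
  apply: smooth_at_pair.
    exact: smooth_at_eval (sT b bx) (smooth_at_fst (smooth_at_snd_id _)).
  exact: smooth_at_eval (sT c cx) (smooth_at_snd (smooth_at_snd_id _)).
have near_g' : \forall p \near P z0, forall z, dom a z -> chart a z = p.1 ->
    ((dom b `&` dom c) `&` id @^-1` vdom j) z /\ g z = sg' p.1.
  exact: (smooth_at_continuous (smooth_at_fst_id (P z0)) near_g).
have qE p : (forall z, dom a z -> chart a z = p.1 ->
    ((dom b `&` dom c) `&` id @^-1` vdom j) z /\ g z = sg' p.1) ->
    forall z, dom a (fib_proj z) -> P z = p ->
    vdom j (fib_proj z) /\ (chart a (proj2M M (h z)), triv j (h z)) = q p.
  move=> near_p z az zp.
  have [[[bz cz] jz] gz] := near_p (fib_proj z) az (congr1 fst zp).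
  split=> //; rewrite (gE z (conj (conj bz cz) jz)) gz hp /q -zp /=.
  congr (_, sg' _ (_, _)).
    by rewrite (tcoord_change hM (a := a)).
  by rewrite (tcoord_change hM (a := a)) ?fib_proj2.
have q0 := qE (P z0) (nbhs_singleton near_g') z0 az0 erefl.
exists (fun p => (s (q p)).2).
  apply: smooth_at_snd; apply: smooth_at_comp sq _.
  apply: smooth_at_on oid _ ss; exists (h z0); last by case: q0.
  by rewrite /= !hp.
apply: filterS near_g' => p near_p z az zp.
have [jz qz] := qE p near_p z az zp.
have := congr1 snd (sE (h z) _); rewrite /= => ->; first by rewrite qz.
by rewrite /= !hp.
Qed.

End local_trivialization.

(** * The connection *)

Section connection_construction.
Context {R : realType} {E : normedModType R} (M : atlas E) (hM : is_manifold M).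
Notation TMxTM := (fib_prod (tproj M) (tproj M)).
Variables (h : T2M M -> TMxTM) (h' : TMxTM -> T2M M).
Hypotheses (hp : forall z, fib_proj (h z) = proj2M M z)
  (hp' : forall z, proj2M M (h' z) = fib_proj z) (hK : cancel h h') (hK' : cancel h' h).
Variables (H K : idx M -> E * (E * E) -> E * E).
Hypothesis HP : forall a z, dom a (proj2M M z) ->
  smooth_at (@chart _ _ (tangent2 M) a z) (H a) /\
  fib_coord a (h z) = H a (@chart _ _ (tangent2 M) a z).
Hypothesis KP : forall a z, dom a (fib_proj z) ->
  smooth_at (chart a (fib_proj z), fib_coord a z) (K a) /\
  (@chart _ _ (tangent2 M) a (h' z)).2 = K a (chart a (fib_proj z), fib_coord a z).

Lemma tangent2_point (a : idx M) (x : M) (e : E * E) : dom a x ->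
  exists z : T2M M, proj2M M z = x /\ @chart _ _ (tangent2 M) a z = (chart a x, e).
Proof.
case: e => u c ax; have [z [zx ze]] := tangent2_surj hM u c ax.
by exists z; split=> //; rewrite -ze -zx.
Qed.

Lemma H_smooth a x e : dom a x -> smooth_at (chart a x, e) (H a).
Proof.
by move=> ax; have [z [zx <-]] := tangent2_point e ax; have [] := HP (z := z) (a := a); rewrite ?zx.
Qed.

Lemma K_smooth a x e : dom a x -> smooth_at (chart a x, e) (K a).
Proof.
by move=> ax; have [z [zx <-]] := fib_surj hM e ax; rewrite -zx; case: (@KP a z); rewrite ?zx.
Qed.

Lemma KH a x e : dom a x -> K a (chart a x, H a (chart a x, e)) = e.
Proof.
move=> ax; have [z [zx ze]] := tangent2_point e ax.
have az : dom a (proj2M M z) by rewrite zx.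
have az' : dom a (fib_proj (h z)) by rewrite hp.
have [_] := KP az'; rewrite hK hp zx.
by have [_ ->] := HP az; rewrite ze.
Qed.

Lemma HK a x e : dom a x -> H a (chart a x, K a (chart a x, e)) = e.
Proof.
move=> ax; have [z [zx ze]] := fib_surj hM e ax.
have az : dom a (fib_proj z) by rewrite zx.
have az' : dom a (proj2M M (h' z)) by rewrite hp'.
have [_] := HP az'; rewrite hK' ze => eH; rewrite [RHS]eH; congr (H a).
have [_] := KP az; rewrite ze zx => <-.
by rewrite [RHS]surjective_pairing /= hp' zx.
Qed.

(** Reading one element of T^2 M, and its image under h, in the charts a and b
    conjugates the local forms of h by the coordinate changes of T^2 M and of
    TM x TM. *)
Lemma H_change a b x u c : dom a x -> dom b x ->
  let s := transition hM a b in let y := chart a x in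
  let T := dclin s y in
  H b (chart b x, (T u, T c + dclin (dclin s) y u u)) =
  (T (H a (y, (u, c))).1, T (H a (y, (u, c))).2).
Proof.
move=> ax bx s y T; have [z [zx ze]] := tangent2_point (u, c) ax.
have az : dom a (proj2M M z) by rewrite zx.
have bz : dom b (proj2M M z) by rewrite zx.
have [_ Ha] := HP az; have [_ Hb] := HP bz.
have := second_order_coord_change hM az bz (congr1 snd ze); rewrite zx => eb.
have <- : @chart _ _ (tangent2 M) b z = (chart b x, (T u, T c + dclin (dclin s) y u u)).
  by rewrite -zx addrC -eb.
rewrite -Hb -ze -Ha /fib_coord /=.
have change (v : TM M) : tproj M v = x -> tcoord b v = T (tcoord a v).
  by move=> vx; rewrite (tcoord_change hM (a := a)) vx.
by rewrite !change ?fib_proj2 ?hp//; rewrite -hp in zx.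
Qed.

(** The Christoffel symbol at p.1 in the direction p.2, written as a composition
    of continuous linear maps so that its smooth dependence on p is visible.
    Fibre derivatives appear as derivatives of H and K in the directions (0, k);
    christoffel_mapE identifies it with christoffel of the fibre maps. *)
Definition christoffel_map (a : idx M) (p : E * E) : clin E E :=
  clin_comp (clin_snd E E) (clin_comp (dclin (K a) (p.1, H a (p.1, 0)))
    (clin_comp (clin_inr E (E * E)%type)
      (2^-1 *: clin_comp (dclin (dclin (H a)) (p.1, 0)
          (clin_inr E (E * E)%type (clin_inl E E p.2)))
        (clin_comp (clin_inr E (E * E)%type) (clin_inl E E))))).

Definition fiber (F : idx M -> E * (E * E) -> E * E) a y (e : E * E) := F a (y, e).

Lemma christoffel_mapE a x u v : dom a x ->
  christoffel_map a (chart a x, u) v =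
  christoffel (fiber H a (chart a x)) (fiber K a (chart a x)) u v.
Proof.
move=> ax; rewrite /christoffel.
rewrite [dclin (dclin _) _ _ _](dclin2_fiber (H_smooth 0 ax)).
rewrite [dclin (fiber K _ _) _ _](dclin_fiber (K_smooth (H a (chart a x, 0)) ax)).
rewrite /christoffel_map /= !clin_compE clin_scaleE !clin_compE.
by rewrite clin_sndE !clin_inrE clin_inlE.
Qed.

Lemma christoffel_map_smooth a x u : dom a x ->
  smooth_at (chart a x, u) (christoffel_map a).
Proof.
move=> ax.
have scst (F G : normedModType R) (z : F) (c : G) := @smooth_at_cst _ F G z c.
have s1 := smooth_at_fst_id (chart a x, u).
have s2 := smooth_at_snd_id (chart a x, u).
have s10 : smooth_at (chart a x, u) (fun p : E * E => (p.1, 0 : E * E)).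
  exact: smooth_at_pair s1 (scst _ _ _ _).
have sH : smooth_at (chart a x, u) (fun p : E * E => H a (p.1, 0)).
  exact: smooth_at_comp s10 (H_smooth 0 ax).
have sK : smooth_at (chart a x, u) (fun p : E * E => dclin (K a) (p.1, H a (p.1, 0))).
  exact: smooth_at_comp (smooth_at_pair s1 sH) (smooth_at_dclin (K_smooth _ ax)).
have sddH : smooth_at (chart a x, u) (fun p : E * E => dclin (dclin (H a)) (p.1, 0 : E * E)).
  exact: smooth_at_comp s10 (smooth_at_dclin (smooth_at_dclin (H_smooth 0 ax))).
apply: smooth_at_compM; first exact: scst.
apply: smooth_at_compM; first exact: sK.
apply: smooth_at_compM; first exact: scst.
apply: (smooth_at_bilinear (@bounded_bilinear_scale _ _)); first exact: scst.
apply: smooth_at_compM; last exact: scst.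
apply: (smooth_at_eval sddH).
by do 2!apply: smooth_at_clin_comp.
Qed.

Lemma christoffel_map_linear a y : linear (fun u => christoffel_map a (y, u)).
Proof.
move=> k u v; apply: clin_ext => z; rewrite clin_addE clin_scaleE.
rewrite /christoffel_map !clin_compE !clin_scaleE !clin_compE /=.
rewrite [clin_inl E E (_ + _)]linearP [clin_inr E _ (_ + _)]linearP.
rewrite [dclin (dclin _) _ (_ + _)]linearP clin_addE clin_scaleE.
rewrite scalerDr scalerA [2^-1 * k]mulrC -scalerA.
by rewrite !(clinD, clinZ).
Qed.

(** christoffel_law for the fibre maps over x, with T the derivative and S the
    second derivative of the transition map. *)
Lemma christoffel_map_law a b x u v : dom a x -> dom b x ->
  let s := transition hM a b in let y := chart a x in let T := dclin s y in
  christoffel_map b (chart b x, T u) (T v) + dclin (dclin s) y u v =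
  T (christoffel_map a (y, u) v).
Proof.
move=> ax bx s y T; rewrite !christoffel_mapE//.
have ss : smooth_at y s by exact: transition_smooth.
apply: (@christoffel_law _ _ _ _ _ _ T (fun u v => dclin (dclin s) y u v)).
- by move=> e; apply: fiber_smooth; exact: H_smooth.
- by move=> e; apply: fiber_smooth; exact: K_smooth.
- by move=> e; apply: fiber_smooth; exact: H_smooth.
- by move=> e; apply: fiber_smooth; exact: K_smooth.
- by move=> e; exact: KH.
- by move=> e; exact: HK.
- by move=> e; exact: KH.
- split.
  + by move=> w k w1 w2; rewrite linearP.
  + by move=> w; exact: clin_linear.
  + exists `|dclin (dclin s) y| => // w1 w2.
    by apply: le_trans (clin_norm_le _ _) _; rewrite ler_wpM2r// clin_norm_le.
- apply: second_derivative_symmetric.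
    by apply: filterS (smooth_at_near ss) => z; exact: smooth_at_differentiable.
  exact: smooth_at_differentiable (smooth_at_dclin ss).
- by move=> u' c; exact: H_change.
Qed.

(** The vector is defined in one chart. Its coordinates have the same form in every
    other chart because the term D^2 sigma (v, u) produced by the change of
    coordinates on T(TM) is the inhomogeneous term D^2 sigma (u, v) of the
    transformation law. *)
Lemma connection_vector (z : TM (tangent M)) (x := tproj M (tproj (tangent M) z)) :
  exists v : TM M, tproj M v = x /\ forall a : idx M, dom a x ->
    tcoord a v = (tcoord (M := tangent M) a z).2 +
      christoffel_map a (chart a x, tcoord a (tproj (tangent M) z))
        (tcoord (M := tangent M) a z).1.
Proof.
have [a ax] := atlas_cover hM x.
pose r (a : idx M) := (tcoord (M := tangent M) a z).2 +
  christoffel_map a (chart a x, tcoord a (tproj (tangent M) z)) (tcoord (M := tangent M) a z).1.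
have [v [vx va]] := tangent_surj hM (r a) ax.
exists v; split; first exact: vx.
move=> b bx.
pose s := transition hM a b.
pose y := chart a x.
pose t := tproj (tangent M) z : TM M.
have ss : smooth_at y s by exact: transition_smooth.
have ev : tcoord b v = dclin s y (tcoord a v).
  by have := @tcoord_change _ _ _ hM v a b; rewrite vx; exact.
have et : tcoord b t = dclin s y (tcoord a t) := @tcoord_change _ _ _ hM t a b ax bx.
have ez := double_tangent_change hM (z := z) ax bx.
have law := christoffel_map_law (tcoord a t) (tcoord (M := tangent M) a z).1 ax bx.
have sym : dclin (dclin s) y (tcoord a t) (tcoord (M := tangent M) a z).1 =
    dclin (dclin s) y (tcoord (M := tangent M) a z).1 (tcoord a t).
  apply: second_derivative_symmetric.
    by apply: filterS (smooth_at_near ss) => p; exact: smooth_at_differentiable.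
  exact: smooth_at_differentiable (smooth_at_dclin ss).
rewrite [tcoord b v]ev va /r clinD -[X in _ + X]law.
rewrite [tcoord (M := tangent M) b z]ez [tcoord b t]et /=.
by rewrite -/s -/y sym addrA addrC addrA.
Qed.

Lemma exists_linear_connection : exists D : tangent (tangent M) -> tangent M, linear_connection D.
Proof.
have [D DP] := choice connection_vector.
exists D.
have Dx z := (DP z).1.
have Dform a : local_form D a (christoffel_map a).
  split.
    have -> : (chart a @` dom a) `*` setT = [set p : E * E | (chart a @` dom a) p.1].
      by apply/seteqP; split=> [p []|p].
    apply/smooth_onP; first exact/open_fst_preimage/open_chart_dom.
    by move=> [y u] [x ax /= <-]; exact: christoffel_map_smooth.
  move=> z az; have [_ /(_ a az)] := DP z; rewrite /= Dx.
  by case: (tcoord (M := tangent M) a z) => v r /= ->.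
split; last first.
  move=> a w [_ wD] y [x ax <-].
  have -> : (fun u => w (chart a x, u)) = (fun u => christoffel_map a (chart a x, u)).
    apply/funext => u; apply: clin_ext => v.
    have [z [zx zu zv]] := double_tangent_surj hM u v 0 ax.
    have az : @dom _ _ (tangent (tangent M)) a z by rewrite /= zx.
    have := wD z az; have := (Dform a).2 z az; rewrite /= zx zu zv => e1 e2.
    by have := congr1 snd (etrans (esym e2) e1); rewrite /= !add0r.
  exact: christoffel_map_linear.
split; last by move=> a; exists (christoffel_map a).
split=> //.
- move=> a b; split.
    rewrite [X in open X](tangent_chart_image hM a b); exact/open_fst_preimage/open_chart_dom2.
  exists (fun p => transition hM a b p.1).
    rewrite [X in smooth_on X](tangent_chart_image hM a b).
    apply/smooth_onP; first exact/open_fst_preimage/open_chart_dom2.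
    by move=> [y u] [x [ax bx] /= <-]; exact: transition_fst_smooth.
  by move=> v [av bv]; rewrite /= transitionE.
move=> v; have [a av] := atlas_cover hM (tproj M v); exists a, a; split=> //.
pose G (p : E * E) : clin (E * E)%type E :=
  clin_comp (christoffel_map a p) (clin_fst E E) + clin_snd E E.
(* Over the chart a, D is (v, r) |-> r + christoffel_map v on the fibres of T(TM). *)
exists (fun t => G (chart a (tproj M t), tcoord a t)); last first.
  move=> z [az _]; have [_ /(_ a az) tE] := DP z; apply: etrans tE _.
  rewrite /G [RHS]clin_addE (clin_compE (christoffel_map _ _) (clin_fst E E)).
  by rewrite clin_fstE clin_sndE addrC.
have imgE (b : idx M) : @chart _ _ (tangent M) b @` (@dom _ _ (tangent M) b `&`
      (@dom _ _ (tangent M) a `&` tproj M @^-1` dom a)) =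
    [set p : E * E | (chart b @` (dom b `&` dom a)) p.1].
  by rewrite -(tangent_chart_image hM b a) [X in _ `&` X]setIid.
have oimg (b : idx M) : open [set p : E * E | (chart b @` (dom b `&` dom a)) p.1].
  exact/open_fst_preimage/open_chart_dom2.
split=> b; first by rewrite imgE.
exists (fun p => G (tangent_transition hM b a p)); last first.
  by move=> t [bt [at_ _]]; rewrite /= tangent_transitionE.
rewrite imgE; apply/smooth_onP => // -[y u] [x [bx ax] /= <-].
have sG w : smooth_at (chart a x, w) G.
  apply: smooth_atD; last exact: smooth_at_cst.
  by apply: smooth_at_compM; [exact: christoffel_map_smooth|exact: smooth_at_cst].
apply: smooth_at_comp (tangent_transition_smooth hM u bx ax) _.
by rewrite /tangent_transition /= transitionE.
Qed.

End connection_construction.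

Theorem theorem2p4 (R : realType) (E : completeNormedModType R) (M : atlas E)
    (hM : is_manifold M)
    (hT2 : exists V : vbundle (proj2M M) (E * E)%type,
      smooth_vbundle (tangent2 M) V /\
      vb_isomorphic V (vb_prod (tangent_vb M) (tangent_vb M))) :
  exists D : tangent (tangent M) -> tangent M, linear_connection D.
Proof.
have [V [hV [h [h' [hm hm' hK hK']]]]] := hT2.
have [H HP] := choice (fun a => forward_local_form hM hV a hm).
have [K KP] := choice (fun a => backward_local_form hM hV a hm').
by apply: (exists_linear_connection hM _ _ hK hK' HP KP); [case: hm|case: hm'].
Qed.
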